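(* Let $T$ be a marriage instance and $\mathcal{M}'\subseteq\mathcal{M}(T)$. The following are equivalent: (1) $\mathcal{M}'$ is internally closed. (2) $\mathcal{M}'$ is inclusionwise maximal among the subsets of $\mathcal{M}(T)$ that (a) are closed with respect to the join operator and (b) satisfy the opposition of interests. (3) $\mathcal{M}'=\mathcal{S}(T')$ for a stable table $T'\subseteq T$ such that (a) the digraphs $D_X(M_Y^{T'},T)$ and $D_Y(M_X^{T'},T)$ have no directed cycle, and (b) for every $\rho\in R_X(T')$ there is no set $R$ of generalized $X$-rotations satisfying the dissection conditions for $(T,T',\rho)$.
   Context: A roommate instance $T$: finite agent set, each agent $z$ has acceptable agents strictly ordered by $>_z$, acceptability symmetric; acceptable pairs are edges. A marriage instance has agents partitioned into $X,Y$ with every edge joining $X$ and $Y$. A matching is a set of disjoint edges; $M(z)$ is $z$'s partner or $\emptyset$, and any acceptable agent is preferred to $\emptyset$. An edge $ab$ blocks $M$ if $b>_aM(a)$ and $a>_bM(b)$; $M$ is stable if unblocked; $M'$ blocks $M$ if an edge of $M'$ blocks $M$. $\mathcal{M}(T),\mathcal{S}(T)$: matchings, stable matchings. A subtable is a subset of edges with induced orders; a stable table is one each of whose edges lies in a stable matching of it. Internally stable: no two members block each other; internally closed: inclusionwise maximal internally stable subset of $\mathcal{M}(T)$. $M\preceq_X M'$ if every $x\in X$ weakly prefers $M'(x)$ to $M(x)$; $\prec_X$ if moreover $M\neq M'$; $\preceq_Y$ similarly. For a table $T'$ with $\mathcal{S}(T')\ne\emptyset$, $M_X^{T'}$ (resp.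 $M_Y^{T'}$) is the stable matching of $T'$ that is the maximum of $(\mathcal{S}(T'),\preceq_X)$ (resp. $(\mathcal{S}(T'),\preceq_Y)$). Join: $M\vee M'=\{xy: x\in X,\ y\in\{M(x),M'(x)\},\ y\ge_x M(x),\ y\ge_x M'(x)\}$; a set is closed w.r.t. join if it contains $M\vee M'$ for all members $M,M'$. A set satisfies opposition of interests if for all members $M,M'$: $M\succeq_X M'$ iff $M'\succeq_Y M$. A generalized $X$-rotation exposed in a matching $M$ within a table $U$ is a sequence $\rho=(x_0,y_0),\dots,(x_{r-1},y_{r-1})$ of pairs of distinct agents, indices mod $r$, with $x_iy_i\in M$, $x_iy_{i+1}\in U$, $x_i>_{y_{i+1}}x_{i+1}$, $y_i>_{x_i}y_{i+1}$ for all $i$. It is a (classical) $X$-rotation of $U$ exposed in $M\in\mathcal{S}(U)$ if moreover $M(y)>_y x_i$ for every $y$ with $x_iy\in U$ and $y_i>_{x_i}y>_{x_i}y_{i+1}$. Elimination $M/\rho$: $x_i$ is matched to $y_{i+1}$, others unchanged; for a set $R=\{\rho_1,\dots,\rho_k\}$, $M/R$ means successive elimination in an order where each $\rho_i$ is exposed in the current matching. $E(\rho)=\{x_iy_i,x_iy_{i+1}\}_i$. $R_X(T')$ is the set of $X$-rotations of $T'$ exposed in some stable matching of $T'$; for $\rho\in R_X(T')$, $R(\rho)$ is the set of $\rho'\in R_X(T')\setminus\{\rho\}$ that are eliminated before $\rho$ in every sequence of successive eliminations of exposed rotations starting from $M_X^{T'}$ containing both; $M_X^{T'}/R(\rho)$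 is the stable matching obtained by eliminating $R(\rho)$ (in which $\rho$ is exposed). The dissection conditions for $(T,T',\rho)$ on a set $R=\{\rho_1,\dots,\rho_k\}$: (i) $R\subseteq R_X(T^* )\setminus R_X(T')$ where $T^*=T'\cup\bigcup_jE(\rho_j)$; (ii) $M_X^{T'}/R(\rho)/\rho=M_X^{T'}/R(\rho)/R$. $D_X(M,U)$: digraph on $X\cup Y$ with arcs $(x,y)$ whenever $xy\in U$, $x>_yM(y)$ and $M(x)>_xy$, and arcs $(y,x')$ whenever $M(y)=x'$. $D_Y(M,U)$ is defined symmetrically with the roles of $X$ and $Y$ swapped. *)

(* Defs.v *)
From HB Require Import structures.
From mathcomp Require Import all_boot.

Set Implicit Arguments.
Unset Strict Implicit.
Unset Printing Implicit Defensive.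

Local Open Scope quotient_scope.

(* [pref z a b] reads a >_z b; it is only meaningful on acceptable agents. *)
Record roommate (A : finType) := Roommate {
  acc : rel A;
  pref : A -> rel A;
  acc_irr : irreflexive acc;
  acc_sym : symmetric acc;
  pref_irr : forall z a, acc z a -> ~~ pref z a a;
  pref_trans : forall z a b c, acc z a -> acc z b -> acc z c ->
    pref z a b -> pref z b c -> pref z a c;
  pref_total : forall z a b, acc z a -> acc z b -> a != b ->
    pref z a b || pref z b a
}.

(* An edge ab is the two-element set [set a; b]; a table is a set of edges of T,
   ordered by the preferences of T. *)
Definition edges (A : finType) (T : roommate A) : {set {set A}} :=
  [set [set p.1; p.2] | p in [pred p : A * A | acc T p.1 p.2]].

(* The two sides of the market are X and Y = ~: X. *)
Definition marriage (A : finType) (T : roommate A) (X : {set A}) : Prop :=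
  forall a b, acc T a b -> (a \in X) != (b \in X).

Definition matchings (A : finType) (U : {set {set A}}) : {set {set {set A}}} :=
  [set M : {set {set A}} | (M \subset U) && trivIset M].

Definition partner (A : finType) (M : {set {set A}}) (z : A) : option A :=
  [pick y | [set z; y] \in M].

(* >_z extended to partners, None being the empty assignment. *)
Definition opref (A : finType) (T : roommate A) (z : A) (o o' : option A) : bool :=
  match o, o' with
  | Some a, Some b => pref T z a b
  | Some _, None => true
  | None, _ => false
  end.

Definition owpref (A : finType) (T : roommate A) (z : A) (o o' : option A) : bool :=
  (o == o') || opref T z o o'.

Section Stability.
Variables (A : finType) (T : roommate A).
Implicit Types (X : {set A}) (U M N : {set {set A}}) (F : {set {set {set A}}}).

Definition edge_blocks (e : {set A}) M : bool :=
  [exists a, exists b, [&& e == [set a; b],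
     opref T a (Some b) (partner M a) & opref T b (Some a) (partner M b)]].

Definition stables U : {set {set {set A}}} :=
  [set M in matchings U | [forall e in U, ~~ edge_blocks e M]].

Definition blocks M' M : bool := [exists e in M', edge_blocks e M].

Definition stable_table U : bool :=
  [forall e in U, [exists M in stables U, e \in M]].

Definition internally_stable F : bool :=
  [forall M in F, forall M' in F, ~~ blocks M' M].

Definition internally_closed F : bool :=
  maxset (fun G : {set {set {set A}}} =>
    (G \subset matchings (edges T)) && internally_stable G) F.

(* M \preceq_X M' *)
Definition side_le X M M' : bool :=
  [forall z in X, owpref T z (partner M' z) (partner M z)].

(* M_X^U; the default set0 is only reached when the maximum does not exist. *)
Definition side_opt X U : {set {set A}} :=
  odflt set0 [pick M in stables U | [forall N in stables U, side_le X N M]].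

Definition join X M M' : {set {set A}} :=
  [set [set p.1; p.2] | p in [pred p : A * A |
     [&& p.1 \in X,
         (Some p.2 == partner M p.1) || (Some p.2 == partner M' p.1),
         owpref T p.1 (Some p.2) (partner M p.1)
       & owpref T p.1 (Some p.2) (partner M' p.1)]]].

Definition join_closed X F : bool :=
  [forall M in F, forall M' in F, join X M M' \in F].

Definition opposition X F : bool :=
  [forall M in F, forall M' in F, side_le X M' M == side_le (~: X) M M'].

(* D_X(M, U); D_Y(M, U) is side_digraph (~: X) M U. *)
Definition side_digraph X M U : rel A := fun a b =>
  [&& a \in X, b \notin X, [set a; b] \in U,
      opref T b (Some a) (partner M b) & opref T a (partner M a) (Some b)]
  || [&& a \notin X, b \in X & partner M a == Some b].

End Stability.

Definition acyclic (A : finType) (D : rel A) : Prop :=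
  forall c : seq A, ucycle D c -> c = [::].

(* The pairs of a rotation are indexed modulo its length, so a rotation is a
   sequence of pairs up to cyclic shift. *)
Definition shift_eq (A : finType) : rel (seq (A * A)) :=
  fun s t => [exists i : 'I_(size s).+1, t == rot i s].

Lemma shift_eqP (A : finType) (s t : seq (A * A)) :
  reflect (exists i, t = rot i s) (shift_eq s t).
Proof.
apply: (iffP existsP) => [[i /eqP st]|[i st]]; first by exists i.
rewrite {t}st.
case: (leqP i (size s)) => [le_i|lt_i].
  by exists (inord i); rewrite inordK.
by exists ord0; rewrite rot0 rot_oversize // ltnW.
Qed.

Lemma shift_eq_refl (A : finType) : reflexive (@shift_eq A).
Proof. by move=> s; apply/shift_eqP; exists 0; rewrite rot0. Qed.

Lemma shift_eq_sym (A : finType) : symmetric (@shift_eq A).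
Proof.
suff H : forall s t : seq (A * A), shift_eq s t -> shift_eq t s.
  by move=> s t; apply/idP/idP; apply: H.
move=> s t /shift_eqP[i st]; rewrite {t}st; apply/shift_eqP.
by exists (size (rot i s) - i); rewrite -/(rotr i (rot i s)) rotK.
Qed.

Lemma shift_eq_trans (A : finType) : transitive (@shift_eq A).
Proof.
move=> t s u /shift_eqP[i st] /shift_eqP[j tu]; rewrite {u}tu {t}st.
apply/shift_eqP.
case: (leqP i (size s)) => [le_i|lt_i]; last first.
  by exists j; rewrite (rot_oversize (ltnW lt_i)).
case: (leqP j (size s)) => [le_j|lt_j]; last first.
  by exists i; rewrite (@rot_oversize _ j) // size_rot ltnW.
by exists (if j + i <= size s then j + i else j + i - size s); rewrite rot_add_mod.
Qed.

Canonical shift_equiv (A : finType) :=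
  EquivRel (@shift_eq A) (@shift_eq_refl A) (@shift_eq_sym A) (@shift_eq_trans A).

Definition rotation (A : finType) := {eq_quot (shift_equiv A)}.

HB.instance Definition _ (A : finType) := Choice.on (rotation A).
HB.instance Definition _ (A : finType) := EqQuotient.on (rotation A).

Definition rot_seq (A : finType) (r : rotation A) : seq (A * A) := repr r.

Section Rotations.
Variables (A : finType) (T : roommate A) (X : {set A}).
Implicit Types (U M N : {set {set A}}) (s : seq (A * A)) (r q : rotation A).

(* s is (x_0, y_0), ..., (x_{r-1}, y_{r-1}) with r > 0; in the relation passed to
   [cycle], p = (x_i, y_i) and p' = (x_{i+1}, y_{i+1}), cyclically. *)
Definition gen_exposed_seq U M s : bool :=
  [&& s != [::], uniq (unzip1 s ++ unzip2 s),
      all (fun p => [&& p.1 \in X, p.2 \notin X & [set p.1; p.2] \in M]) s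
    & cycle (fun p p' => [&& [set p.1; p'.2] \in U,
                             pref T p'.2 p.1 p'.1 & pref T p.1 p.2 p'.2]) s].

Definition exposed_seq U M s : bool :=
  [&& M \in stables T U, gen_exposed_seq U M s
    & cycle (fun p p' => [forall y,
        [&& [set p.1; y] \in U, pref T p.1 p.2 y & pref T p.1 y p'.2]
        ==> opref T y (partner M y) (Some p.1)]) s].

Definition gen_exposed U M r : bool := gen_exposed_seq U M (rot_seq r).

Definition exposed U M r : bool := exposed_seq U M (rot_seq r).

(* {x_i y_i}_i and {x_i y_{i+1}}_i *)
Definition rot_old r : {set {set A}} :=
  [set [set p.1; p.2] | p in rot_seq r].
Definition rot_new r : {set {set A}} :=
  [set [set p.1; (next (rot_seq r) p).2] | p in rot_seq r].

Definition rot_edges r : {set {set A}} := rot_old r :|: rot_new r.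

Definition elim M r : {set {set A}} := (M :\: rot_old r) :|: rot_new r.

Definition gen_rotation U r : bool :=
  [exists M in matchings U, gen_exposed U M r].

(* R_X(U) *)
Definition rotations U r : bool := [exists M in stables T U, exposed U M r].

(* ex M r is the notion of r being exposed in M. *)
Fixpoint eliminable (ex : {set {set A}} -> rotation A -> bool) M
    (s : seq (rotation A)) : bool :=
  if s is r :: s' then ex M r && eliminable ex (elim M r) s' else true.

(* N = M/P for the set P of rotations *)
Definition elim_set (ex : {set {set A}} -> rotation A -> bool) M
    (P : rotation A -> Prop) N : Prop :=
  exists s : seq (rotation A),
    [/\ uniq s, forall r, r \in s <-> P r, eliminable ex M s & N = foldl elim M s].

(* preceding U r is R(r), relative to the table U. *)
Definition preceding U r q : Prop :=
  [/\ rotations U q, q != r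
    & forall s : seq (rotation A), eliminable (exposed U) (side_opt T X U) s ->
        q \in s -> r \in s -> index q s < index r s].

(* The dissection conditions for (T, U, r) on the set R of the members of the
   sequence Rs; Us is T^*. *)
Definition dissection U r (Rs : seq (rotation A)) : Prop :=
  let Us := U :|: \bigcup_(q <- Rs) rot_edges q in
  (forall q, q \in Rs -> rotations Us q && ~~ rotations U q) /\
  (exists N, elim_set (exposed U) (side_opt T X U) (preceding U r) N /\
             elim_set (gen_exposed Us) N (fun q => q \in Rs) (elim N r)).

End Rotations.

(* Main.v *)
Require Import Defs.
From mathcomp Require Import all_boot zify.

(* Any internally stable family G lies in S(V) for V the union of its members,
   and S(V) is again internally stable, join-closed and satisfies opposition of
   interests; conversely, an edge of M' blocking M contradicts opposition applied
   to M and the join of M and M'. This gives (1) <-> (2), and shows that closed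
   families are S(U) for stable tables U.

   For (1) <-> (3), the key fact is a dichotomy: if the rotation r is exposed in
   N, a stable matching L agrees with N or better on all X-agents of r, or with
   N/r or worse on all of them. Hence every matching lying between N and N/r is
   compatible with S(U), so that a dissection of r (as well as a cycle in one of
   the two digraphs) yields a matching that can be added to S(U). Conversely, if
   S(U) is properly contained in S(V), acyclicity forces the two lattices to have
   the same extrema; an edge of V outside U is then skipped by some rotation r of
   U, and a maximal chain of S(V) from M_X/R(r) to M_X/R(r)/r through a matching
   using that edge dissects r. *)

Set Implicit Arguments.
Unset Strict Implicit.
Unset Printing Implicit Defensive.

(** * Scores and blocking *)

(** Every comparison becomes an inequality between natural numbers: agents score their partners, so
    that join, meet, opposition of interests and elimination are statements about [maxn], [minn] and
    [<=]. Scores are taken in [T], never in a subtable, so matchings that are stable for different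
    tables compare directly. The dichotomy is where the classical condition on rotations is used: a
    generalized rotation may jump over agents, and further stable matchings may then sit in the gap.
    A rotation fixes the scores of its X-agents just before and just after its elimination, whatever
    the matching or table in which it is exposed. This is what allows one rotation to be recognized
    at several places of a lattice and in several tables. In particular R(r), which is defined
    through all elimination sequences, can be read off a single chain from the X-optimal matching
    down to the largest matching exposing r. *)

Section Scores.
Variables (A : finType) (T : roommate A).
Implicit Types (a b z : A) (o : option A) (U M N : {set {set A}}).

(** One plus the number of acceptable agents ranked below the partner; 0 is kept for being single,
    so larger is better. The value is meaningful only for acceptable partners, which [okpartner]
    records. *)
Definition score z o : nat :=
  if o is Some a then #|[set b | acc T z b & pref T z a b]|.+1 else 0.

Definition mscore M z : nat := score z (partner M z).

Definition okpartner z o : bool := if o is Some a then acc T z a else true.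

Lemma pref_score z a b : acc T z a -> acc T z b ->
  pref T z a b -> score z (Some b) < score z (Some a).
Proof.
move=> za zb ab; rewrite /= ltnS; apply/proper_card/properP; split.
  apply/subsetP=> c; rewrite !inE => /andP[zc bc]; rewrite zc /=.
  exact: pref_trans ab bc.
by exists b; rewrite !inE ?zb ?ab //=; apply: pref_irr.
Qed.

Lemma opref_score z o o' : okpartner z o -> okpartner z o' ->
  opref T z o o' = (score z o' < score z o).
Proof.
case: o o' => [a|] [b|] //= za zb.
apply/idP/idP => [|lt_ba]; first exact: pref_score.
have [ab|neq_ab] := eqVneq a b; first by move: lt_ba; rewrite ab ltnn.
case/orP: (pref_total za zb neq_ab) => // /(pref_score zb za) /=.
by rewrite ltnNge ltnW.
Qed.

Lemma score_inj z o o' : okpartner z o -> okpartner z o' ->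
  score z o = score z o' -> o = o'.
Proof.
case: o o' => [a|] [b|] // za zb.
have [-> //|neq_ab] := eqVneq a b.
case/orP: (pref_total za zb neq_ab) => [/(pref_score za zb)|/(pref_score zb za)];
  by move=> + e; rewrite e ltnn.
Qed.

Lemma owpref_score z o o' : okpartner z o -> okpartner z o' ->
  owpref T z o o' = (score z o' <= score z o).
Proof.
move=> zo zo'; rewrite /owpref opref_score // [RHS]leq_eqVlt; congr (_ || _).
by apply/eqP/eqP => [->|/esym/(score_inj zo zo')].
Qed.

Lemma set2_inj a b b' : [set a; b] = [set a; b'] -> b = b'.
Proof.
move=> /setP e; have:= e b; have:= e b'; rewrite !inE !eqxx !orbT.
by case: (eqVneq b' a) => [->|_ /= /eqP]; case: (eqVneq b a) => //= _ _ /esym/eqP.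
Qed.

Lemma set2_eq a b c d : [set a; b] = [set c; d] ->
  (a = c /\ b = d) \/ (a = d /\ b = c).
Proof.
move=> e; have: a \in [set c; d] by rewrite -e !inE eqxx.
rewrite !inE => /orP[] /eqP ac; [left | right]; split=> //.
  by move: e; rewrite ac => /set2_inj.
by move: e; rewrite ac [[set c; d]]setUC => /set2_inj.
Qed.

Lemma edgesE a b : ([set a; b] \in edges T) = acc T a b.
Proof.
apply/imsetP/idP => [[p]|ab]; last by exists (a, b).
by rewrite inE => pp /set2_eq[[-> ->]|[-> ->]] //; rewrite acc_sym.
Qed.

Lemma edgesP e : reflect (exists a b, acc T a b /\ e = [set a; b]) (e \in edges T).
Proof.
apply: (iffP imsetP) => [[[a b]]|[a [b [ab ->]]]]; last by exists (a, b).
by rewrite inE => ab ->; exists a, b.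
Qed.

Section Matching.
Variable M : {set {set A}}.
Hypothesis mM : M \in matchings (edges T).

Lemma matching_acc a b : [set a; b] \in M -> acc T a b.
Proof. by move: mM; rewrite inE => /andP[/subsetP sM _] /sM; rewrite edgesE. Qed.

Lemma matching_uniq a b b' : [set a; b] \in M -> [set a; b'] \in M -> b = b'.
Proof.
move: mM; rewrite inE => /andP[_ /trivIsetP tM] ab ab'.
apply/(@set2_inj a)/eqP/negPn/negP => neq.
by have /pred0P/(_ a) := tM _ _ ab ab' neq; rewrite /= !inE eqxx.
Qed.

Lemma partnerE a b : (partner M a == Some b) = ([set a; b] \in M).
Proof.
rewrite /partner; case: pickP => [c ac|/(_ b) /= -> //].
apply/eqP/idP => [[<-] //|ab]; congr Some; exact: matching_uniq ac ab.
Qed.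

Lemma partner_Some a b : [set a; b] \in M -> partner M a = Some b.
Proof. by rewrite -partnerE => /eqP. Qed.

Lemma partner_sym a b : partner M a = Some b -> partner M b = Some a.
Proof. by move/eqP; rewrite partnerE setUC -partnerE => /eqP. Qed.

Lemma partner_ok a : okpartner a (partner M a).
Proof.
case E: (partner M a) => [b|] //=; apply: matching_acc.
by rewrite -partnerE E.
Qed.

Lemma mscore_edge a b : [set a; b] \in M -> mscore M a = score a (Some b).
Proof. by rewrite /mscore => /partner_Some ->. Qed.

Lemma mscore_edge_sym a b : [set a; b] \in M -> mscore M b = score b (Some a).
Proof. by rewrite setUC; apply: mscore_edge. Qed.

Lemma mscore_edge_gt0 a b : [set a; b] \in M -> 0 < mscore M a.
Proof. by move/mscore_edge->. Qed.

Lemma mscore_gt0 a : 0 < mscore M a -> exists b, [set a; b] \in M.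
Proof.
rewrite /mscore; case E: (partner M a) => [b|] // _.
by exists b; rewrite -partnerE E.
Qed.

Lemma edge_of_score a b : acc T a b -> mscore M a = score a (Some b) ->
  [set a; b] \in M.
Proof.
by move=> ab /score_inj; rewrite -partnerE => -> //; apply: partner_ok.
Qed.

End Matching.

Definition unblocked (E : {set {set A}}) M : Prop := forall a b,
  [set a; b] \in E -> (score a (Some b) <= mscore M a) || (score b (Some a) <= mscore M b).

Lemma edge_blocksE M a b : M \in matchings (edges T) -> acc T a b ->
  edge_blocks T [set a; b] M =
  (mscore M a < score a (Some b)) && (mscore M b < score b (Some a)).
Proof.
move=> mM ab; have ba : acc T b a by rewrite acc_sym.
have E c d : acc T c d ->
    opref T c (Some d) (partner M c) = (mscore M c < score c (Some d)).
  by move=> cd; rewrite opref_score // partner_ok.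
apply/existsP/andP => [[c /existsP[d /and3P[/eqP]]]|[]].
  by case/set2_eq => [[<- <-]|[<- <-]]; rewrite !E // => ? ?; split.
by move=> h1 h2; exists a; apply/existsP; exists b; rewrite eqxx !E // h1.
Qed.

Lemma unblockedP (E : {set {set A}}) M : E \subset edges T -> M \in matchings (edges T) ->
  reflect (unblocked E M) [forall e in E, ~~ edge_blocks T e M].
Proof.
move=> /subsetP sE mM; apply: (iffP forall_inP) => [h a b ab|h e eE].
  have:= h _ ab; rewrite edge_blocksE ?negb_and -?leqNgt //.
  by rewrite -edgesE sE.
have /edgesP[a [b [ab ee]]] := sE _ eE; rewrite ee in eE *.
by rewrite edge_blocksE // negb_and -!leqNgt; apply: h.
Qed.

Lemma blocksE M' M : M' \in matchings (edges T) -> M \in matchings (edges T) ->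
  reflect (unblocked M' M) (~~ blocks T M' M).
Proof.
move=> mM' mM; rewrite /blocks negb_exists_in; apply: unblockedP => //.
by move: mM'; rewrite inE => /andP[].
Qed.

Lemma matchings_sub U M : U \subset edges T -> M \in matchings U ->
  M \in matchings (edges T).
Proof. by move=> sU; rewrite !inE => /andP[sM ->]; rewrite (subset_trans sM). Qed.

Lemma stablesP U M : U \subset edges T ->
  reflect [/\ M \in matchings (edges T), M \subset U & unblocked U M] (M \in stables T U).
Proof.
move=> sU; rewrite [M \in stables _ _]inE; apply: (iffP andP) => [[mM ub]|[mM sM ub]].
  have mM' := matchings_sub sU mM.
  by split=> //; [move: mM; rewrite inE => /andP[] | apply/unblockedP].
split; last exact/unblockedP.
by move: mM; rewrite !inE sM => /andP[].
Qed.

Lemma unblocked_sub (E E' : {set {set A}}) M : E \subset E' -> unblocked E' M -> unblocked E M.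
Proof. by move=> /subsetP sE ub a b ab; apply: ub; apply: sE. Qed.

Section Pair.
Variables M M' : {set {set A}}.
Hypotheses (mM : M \in matchings (edges T)) (mM' : M' \in matchings (edges T)).

(** Since ab does not block M, b weakly prefers M; equality of scores would put ab in M and
    contradict the strict gain of a. *)
Lemma mscore_opposite a b : unblocked M' M -> [set a; b] \in M' ->
  mscore M a < mscore M' a -> mscore M' b < mscore M b.
Proof.
move=> ub ab; have abT := matching_acc mM' ab.
have:= ub _ _ ab; rewrite (mscore_edge mM' ab) (mscore_edge_sym mM' ab).
case/orP=> [|]; first lia.
rewrite leq_eqVlt => /orP[/eqP e|//].
have ba : [set b; a] \in M by apply: edge_of_score; rewrite // acc_sym.
by rewrite (mscore_edge_sym mM ba) ltnn.
Qed.

End Pair.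

(** Single agents are sent to themselves, so that [mate M] is a total involution, hence
    injective. *)
Definition mate M z : A := odflt z (partner M z).

Lemma mate_inj M : M \in matchings (edges T) -> injective (mate M).
Proof.
move=> mM; apply: (can_inj (g := mate M)) => a; rewrite /mate.
case E: (partner M a) => [b|] /=; last by rewrite E.
by rewrite (partner_sym mM E).
Qed.

(* Those who prefer M are matched by M to those who prefer M', and M' maps
   the latter back injectively, so both maps are onto. *)
Lemma prefers_decomposition M M' a :
  M \in matchings (edges T) -> M' \in matchings (edges T) ->
  unblocked M M' -> unblocked M' M -> mscore M' a < mscore M a ->
  exists2 b, [set a; b] \in M' & mscore M b < mscore M' b.
Proof.
move=> mM mM' ub ub'; pose P N N' := [set c | mscore N' c < mscore N c].
have mapP N N' : N \in matchings (edges T) -> N' \in matchings (edges T) ->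
    unblocked N N' -> mate N @: P N N' \subset P N' N.
  move=> mN mN' u; apply/subsetP => _ /imsetP[c cP ->]; move: cP; rewrite !inE => lt.
  have [d cd] := mscore_gt0 mN (leq_ltn_trans (leq0n _) lt).
  rewrite /mate (partner_Some mN cd) /=; exact: mscore_opposite u cd lt.
have s1 := mapP _ _ mM mM' ub; have s2 := mapP _ _ mM' mM ub'.
have/eqP c2: mate M' @: P M' M == P M M'.
  rewrite eqEcard s2 card_imset; last exact: mate_inj.
  by rewrite -(card_imset _ (mate_inj mM)) subset_leq_card.
move=> lt; have : a \in P M M' by rewrite inE.
rewrite -c2 => /imsetP[b]; rewrite inE => lt' ->; exists b => //.
have [d bd] := mscore_gt0 mM' (leq_ltn_trans (leq0n _) lt').
by rewrite /mate (partner_Some mM' bd) /= setUC.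
Qed.

End Scores.

Arguments score : simpl never.

(** * Two-sided markets: opposition of interests and the join *)

Section Sides.
Variables (A : finType) (T : roommate A) (X : {set A}).
Hypothesis hT : marriage T X.
Implicit Types (a b x y z : A) (U M N : {set {set A}}).

Lemma marriage_setC : marriage T (~: X).
Proof. by move=> a b /hT; rewrite !inE; case: (a \in X); case: (b \in X). Qed.

Lemma acc_side x y : acc T x y -> (y \in X) = (x \notin X).
Proof. by move/hT; case: (x \in X); case: (y \in X). Qed.

Lemma edges_side e : e \in edges T ->
  exists x y, [/\ x \in X, y \notin X, acc T x y & e = [set x; y]].
Proof.
case/edgesP=> a [b [ab ->]]; have:= acc_side ab.
case: (boolP (a \in X)) => aX bX; first by exists a, b; rewrite bX.
by exists b, a; rewrite acc_sym setUC bX.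
Qed.

Lemma matching_side M x y : M \in matchings (edges T) -> [set x; y] \in M ->
  (y \in X) = (x \notin X).
Proof. by move=> mM /(matching_acc mM)/acc_side. Qed.

Lemma set2_side x y x' y' : x \in X -> y \notin X -> x' \in X -> y' \notin X ->
  [set x; y] = [set x'; y'] -> x = x' /\ y = y'.
Proof. by move=> xX yX x'X y'X /set2_eq[//|[e _]]; move: y'X; rewrite -e xX. Qed.

Lemma matchings_intro N : N \subset edges T ->
  (forall x y y', x \in X -> [set x; y] \in N -> [set x; y'] \in N -> y = y') ->
  (forall x x' y, x \in X -> x' \in X -> y \notin X ->
     [set x; y] \in N -> [set x'; y] \in N -> x = x') ->
  N \in matchings (edges T).
Proof.
move=> sN ux uy; rewrite inE sN; apply/trivIsetP => e f eN fN nef.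
have [x [y [xX yX xy ee]]] := edges_side (subsetP sN _ eN).
have [u [v [uX vX uv ef]]] := edges_side (subsetP sN _ fN).
rewrite {}ee in eN nef *; rewrite {}ef in fN nef *.
apply/pred0P => z /=; apply/negP; rewrite !inE.
case/andP=> /orP[] /eqP -> /orP[] /eqP h.
- by move/eqP: nef; rewrite -h in fN *; rewrite (ux _ _ _ xX eN fN).
- by move: vX; rewrite -h xX.
- by move: yX; rewrite h uX.
- by move/eqP: nef; rewrite -h in fN *; rewrite (uy _ _ _ xX uX yX eN fN).
Qed.

Lemma matching_eq M N : M \in matchings (edges T) -> N \in matchings (edges T) ->
  (forall x, x \in X -> mscore T M x = mscore T N x) -> M = N.
Proof.
suff h M' N' : M' \in matchings (edges T) -> N' \in matchings (edges T) ->
    (forall x, x \in X -> mscore T M' x = mscore T N' x) -> M' \subset N'.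
  by move=> mM mN e; apply/eqP; rewrite eqEsubset !h // => x xX; rewrite e.
move=> mM mN e; apply/subsetP => f fM.
have sM : M' \subset edges T by move: mM; rewrite inE => /andP[].
have [x [y [xX yX xy ef]]] := edges_side (subsetP sM _ fM); rewrite ef in fM *.
by apply: (edge_of_score mN xy); rewrite -e // (mscore_edge mM fM).
Qed.

Lemma unblocked_intro (E : {set {set A}}) M : E \subset edges T ->
  (forall x y, x \in X -> y \notin X -> [set x; y] \in E ->
    (score T x (Some y) <= mscore T M x) || (score T y (Some x) <= mscore T M y)) ->
  unblocked T E M.
Proof.
move=> sE h a b ab; have := subsetP sE _ ab; rewrite edgesE => /acc_side.
case: (boolP (a \in X)) => aX bX; first by apply: h; rewrite ?bX.
by rewrite orbC; apply: h; rewrite ?bX // setUC.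
Qed.

Definition lower M N : Prop := forall x, x \in X -> mscore T M x <= mscore T N x.

Lemma side_leP M N : M \in matchings (edges T) -> N \in matchings (edges T) ->
  reflect (lower M N) (side_le T X M N).
Proof.
move=> mM mN; apply: (iffP forall_inP) => h x xX; have:= h x xX;
  by rewrite owpref_score ?(partner_ok mM) ?(partner_ok mN).
Qed.

(** A y gaining in N would be matched in M to an agent of X losing in N, by
    [prefers_decomposition]. *)
Lemma lower_opposite M N y : M \in matchings (edges T) -> N \in matchings (edges T) ->
  unblocked T M N -> unblocked T N M -> lower M N -> y \notin X ->
  mscore T N y <= mscore T M y.
Proof.
move=> mM mN u u' le yX; rewrite leqNgt; apply/negP => lt.
have [x yx] := prefers_decomposition mN mM u' u lt.
by rewrite ltnNge le // (matching_side mM yx).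
Qed.

Lemma lower_anti M N : M \in matchings (edges T) -> N \in matchings (edges T) ->
  lower M N -> lower N M -> M = N.
Proof.
move=> mM mN h1 h2; apply: matching_eq => // x xX.
by apply/eqP; rewrite eqn_leq h1 ?h2.
Qed.

Lemma in_join M N x y : M \in matchings (edges T) -> N \in matchings (edges T) ->
  x \in X -> y \notin X ->
  ([set x; y] \in join T X M N) =
  ([set x; y] \in M) && (mscore T N x <= mscore T M x) ||
  ([set x; y] \in N) && (mscore T M x <= mscore T N x).
Proof.
move=> mM mN xX yX; apply/imsetP/idP.
  move=> [[u v]]; rewrite inE /= => /and4P[uX].
  rewrite [_ == partner M _]eq_sym [_ == partner N _]eq_sym (partnerE mM) (partnerE mN) => uv.
  have uvT : acc T u v by case/orP: uv => [/(matching_acc mM)|/(matching_acc mN)].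
  have vX : v \notin X by rewrite (acc_side uvT) uX.
  rewrite !owpref_score ?partner_ok // => h1 h2 /(set2_side xX yX uX vX)[-> ->].
  case/orP: uv => uv; rewrite uv /=.
    by rewrite -(mscore_edge mM uv) in h2; rewrite /mscore h2.
  by rewrite -(mscore_edge mN uv) in h1; rewrite [X in _ || X]h1 orbT.
move=> h; exists (x, y) => //; rewrite inE /= xX /=.
rewrite [_ == partner M _]eq_sym [_ == partner N _]eq_sym (partnerE mM) (partnerE mN).
have xyT : acc T x y.
  by case/orP: h => /andP[] => [/(matching_acc mM)|/(matching_acc mN)].
rewrite !owpref_score ?partner_ok //.
case/orP: h => /andP[xy le]; rewrite xy ?orbT /=.
  by rewrite -(mscore_edge mM xy) leqnn.
by rewrite -(mscore_edge mN xy) leqnn andbT.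
Qed.

Lemma join_sub M N : M \in matchings (edges T) -> N \in matchings (edges T) ->
  join T X M N \subset M :|: N.
Proof.
move=> mM mN; apply/subsetP => e /imsetP[[x y]]; rewrite inE /= => /and4P[xX].
rewrite [_ == partner M _]eq_sym [_ == partner N _]eq_sym (partnerE mM) (partnerE mN) => xy _ _ ->.
by rewrite inE.
Qed.

Section Join.
Variable U : {set {set A}}.
Hypothesis sU : U \subset edges T.
Variables M N : {set {set A}}.
Hypotheses (sM : M \in stables T U) (sN : N \in stables T U).

(** Each x keeps the better of its two partners. That no y is chosen twice, and that y ends up with
    the worse of its two partners, both come from the opposition between the ends of an edge of M or
    N. *)
Lemma join_stable : [/\ join T X M N \in stables T U,
  forall x, x \in X -> mscore T (join T X M N) x = maxn (mscore T M x) (mscore T N x)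
  & forall y, y \notin X ->
      mscore T (join T X M N) y = minn (mscore T M y) (mscore T N y)].
Proof.
have [mM subM uM] := stablesP _ sU sM; have [mN subN uN] := stablesP _ sU sN.
have uMN : unblocked T M N := unblocked_sub subM uN.
have uNM : unblocked T N M := unblocked_sub subN uM.
set J := join T X M N.
have subJ : J \subset U.
  by apply: subset_trans (join_sub mM mN) _; rewrite subUset subM.
have inJ x y : x \in X -> y \notin X -> [set x; y] \in J = _ := in_join mM mN.
have yX' x y : x \in X -> [set x; y] \in U -> y \notin X.
  by move=> xX /(subsetP sU); rewrite edgesE => /acc_side ->; rewrite xX.
(* A tie at x or x' makes both partners of y in the same matching. If both preferences are strict,
   [mscore_opposite] makes y strictly prefer N to M and M to N. *)
have cross x x' y : x \in X -> x' \in X -> [set x; y] \in M -> [set x'; y] \in N ->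
    mscore T N x <= mscore T M x -> mscore T M x' <= mscore T N x' -> x = x'.
  move=> xX x'X xy x'y; rewrite leq_eqVlt => /orP[/eqP e _|lt].
    apply: (@matching_uniq _ _ _ mN y); rewrite setUC //.
    by apply: (edge_of_score mN (matching_acc mM xy)); rewrite e (mscore_edge mM xy).
  rewrite leq_eqVlt => /orP[/eqP e|lt'].
    apply: (@matching_uniq _ _ _ mM y); rewrite setUC //.
    by apply: (edge_of_score mM (matching_acc mN x'y)); rewrite e (mscore_edge mN x'y).
  have := mscore_opposite mN mM uMN xy lt.
  by have := mscore_opposite mM mN uNM x'y lt'; clear; lia.
have mJ : J \in matchings (edges T).
  apply: matchings_intro; first exact: subset_trans subJ sU.
    move=> x y y' xX xy xy'.
    have yX := yX' _ _ xX (subsetP subJ _ xy).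
    have y'X := yX' _ _ xX (subsetP subJ _ xy').
    move: xy xy'; rewrite !inJ //.
    case/orP=> /andP[xy le] /orP[] /andP[xy' le'].
    - exact: (matching_uniq mM xy xy').
    - have e : mscore T M x = mscore T N x by apply/eqP; rewrite eqn_leq le le'.
      apply: (matching_uniq mM xy); apply: (edge_of_score mM (matching_acc mN xy')).
      by rewrite e (mscore_edge mN xy').
    - have e : mscore T M x = mscore T N x by apply/eqP; rewrite eqn_leq le le'.
      apply: (matching_uniq mN xy); apply: (edge_of_score mN (matching_acc mM xy')).
      by rewrite -e (mscore_edge mM xy').
    - exact: (matching_uniq mN xy xy').
  move=> x x' y xX x'X yX; rewrite !inJ //.
  case/orP=> /andP[xy le] /orP[] /andP[xy' le'].
  - by apply: (@matching_uniq _ _ _ mM y); rewrite setUC.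
  - exact: cross xy xy' le le'.
  - by apply/esym; apply: cross xy' xy le' le.
  - by apply: (@matching_uniq _ _ _ mN y); rewrite setUC.
have J0 z : mscore T M z = 0 -> mscore T N z = 0 -> mscore T J z = 0.
  move=> M0 N0; case: (posnP (mscore T J z)) => // /(mscore_gt0 mJ)[c zc].
  have := subsetP (join_sub mM mN) _ zc; rewrite inE.
  by case/orP=> [/(mscore_edge_gt0 mM)|/(mscore_edge_gt0 mN)]; rewrite ?M0 ?N0.
have Jx x : x \in X -> mscore T J x = maxn (mscore T M x) (mscore T N x).
  move=> xX; have [le|/ltnW le] := leqP (mscore T M x) (mscore T N x).
    case: (posnP (mscore T N x)) => [e0|/(mscore_gt0 mN)[y xy]].
      by rewrite J0 ?e0 //; move: le; rewrite e0 leqn0 => /eqP.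
    rewrite (mscore_edge mN xy) (@mscore_edge _ _ _ mJ x y) // inJ ?xy ?le ?orbT //.
    exact: yX' (subsetP subN _ xy).
  case: (posnP (mscore T M x)) => [e0|/(mscore_gt0 mM)[y xy]].
    by rewrite J0 ?e0 //; move: le; rewrite e0 leqn0 => /eqP.
  rewrite (mscore_edge mM xy) (@mscore_edge _ _ _ mJ x y) // inJ ?xy ?le ?orbT //.
  exact: yX' (subsetP subM _ xy).
(* If y strictly prefers one matching, its partner in the other one strictly prefers that other one,
   and therefore chooses y in the join. *)
have Jy y : y \notin X -> mscore T J y = minn (mscore T M y) (mscore T N y).
  move=> yX; case: (ltngtP (mscore T M y) (mscore T N y)) => [lt|lt|e].
  - have [x yx lt'] := prefers_decomposition mN mM uNM uMN lt.
    have xX : x \in X by rewrite (matching_side mM yx).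
    rewrite (mscore_edge mM yx) (@mscore_edge _ _ _ mJ y x) // setUC inJ //.
    by rewrite setUC yx ltnW.
  - have [x yx lt'] := prefers_decomposition mM mN uMN uNM lt.
    have xX : x \in X by rewrite (matching_side mN yx).
    rewrite (mscore_edge mN yx) (@mscore_edge _ _ _ mJ y x) // setUC inJ //.
    by rewrite setUC yx (ltnW lt') orbT.
  case: (posnP (mscore T M y)) => [e0|/(mscore_gt0 mM)[x yx]].
    by rewrite e0 J0 // -e.
  have yx' : [set y; x] \in N.
    by apply: (edge_of_score mN (matching_acc mM yx)); rewrite -e (mscore_edge mM yx).
  have xX : x \in X by rewrite (matching_side mM yx).
  rewrite (mscore_edge mM yx) (@mscore_edge _ _ _ mJ y x) // setUC inJ //.
  by rewrite setUC yx yx' leq_total.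
(* An edge fails to block M and N each at one of its ends: once at x is enough for the maximum,
   otherwise it is twice at y, as the minimum requires. *)
split=> //; apply/stablesP => //; split=> //; apply: unblocked_intro => // x y xX yX xy.
by have := uM _ _ xy; have := uN _ _ xy; rewrite Jx // Jy //; clear; lia.
Qed.

End Join.
End Sides.

(** * The lattice of stable matchings *)

Section StableLattice.
Variables (A : finType) (T : roommate A) (X : {set A}).
Hypothesis hT : marriage T X.
Implicit Types (x y : A) (U V M N L : {set {set A}}) (F G : {set {set {set A}}}).

Section Table.
Variable U : {set {set A}}.
Hypothesis sU : U \subset edges T.

Lemma stables_matching M : M \in stables T U -> M \in matchings (edges T).
Proof. by case/stablesP. Qed.

Lemma stables_subset M : M \in stables T U -> M \subset U.
Proof. by case/stablesP. Qed.

Lemma stables_unblocked M N : M \in stables T U -> N \in stables T U -> unblocked T M N.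
Proof.
by move=> /stables_subset sM /stablesP-/(_ sU)[_ _ uN]; apply: unblocked_sub uN.
Qed.

(** The meet for X is the join for the opposite side. *)
Lemma meet_stable M N : M \in stables T U -> N \in stables T U ->
  [/\ join T (~: X) M N \in stables T U,
  forall x, x \in X ->
    mscore T (join T (~: X) M N) x = minn (mscore T M x) (mscore T N x)
  & forall y, y \notin X ->
    mscore T (join T (~: X) M N) y = maxn (mscore T M y) (mscore T N y)].
Proof.
move=> sM sN; have [sJ Jx Jy] := join_stable (marriage_setC hT) sU sM sN.
by split=> // z zX; [apply: Jy | apply: Jx]; rewrite !inE ?zX.
Qed.

(** K is the meet of M with the join of L and N. When N lies below M, this truncates L to the
    interval from N to M. *)
Lemma median_stable L N M :
  L \in stables T U -> N \in stables T U -> M \in stables T U ->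
  exists K, [/\ K \in stables T U,
  forall x, x \in X ->
    mscore T K x = minn (maxn (mscore T L x) (mscore T N x)) (mscore T M x)
  & forall y, y \notin X ->
    mscore T K y = maxn (minn (mscore T L y) (mscore T N y)) (mscore T M y)].
Proof.
move=> sL sN sM; have [sJ Jx Jy] := join_stable hT sU sL sN.
have [sK Kx Ky] := meet_stable sJ sM; exists (join T (~: X) (join T X L N) M).
by split=> // z zX; [rewrite Kx ?Jx | rewrite Ky ?Jy].
Qed.

Lemma stable_opposite M N y : M \in stables T U -> N \in stables T U ->
  lower T X M N -> y \notin X -> mscore T N y <= mscore T M y.
Proof.
move=> sM sN; apply: lower_opposite; rewrite ?stables_matching //;
  exact: stables_unblocked.
Qed.

(** A member of largest total score over X absorbs every join. [P] is left abstract because the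
    lemma serves both for all stable matchings and for those exposing a given rotation. *)
Lemma join_closed_max (P : pred {set {set A}}) M0 : P M0 ->
  (forall M, P M -> M \in stables T U) ->
  (forall M N, P M -> P N -> P (join T X M N)) ->
  exists2 M, P M & forall N, P N -> lower T X N M.
Proof.
move=> PM0 sP jP; pose total M := \sum_(x in X) mscore T M x.
have [M PM maxM] := @arg_maxnP _ M0 P total PM0.
exists M => // N PN; have PJ := jP _ _ PN PM; move: (maxM _ PJ) => le.
have [_ Jx _] := join_stable hT sU (sP _ PN) (sP _ PM).
(* The equality case of the summed inequalities: equal totals force the join and M to agree at each
   x. *)
have [/= le1 e] := leqif_sum (fun x (xX : x \in X) =>
  leqif_eq (leq_trans (leq_maxr (mscore T N x) (mscore T M x))
                      (eq_leq (esym (Jx x xX))))).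
have : total M == total (join T X N M) by rewrite eqn_leq le1; exact: le.
rewrite e => /forall_inP h x xX; have /eqP := h x xX.
by rewrite Jx // => ->; rewrite leq_maxl.
Qed.

Lemma side_opt_spec : stables T U != set0 ->
  side_opt T X U \in stables T U /\
  forall N, N \in stables T U -> lower T X N (side_opt T X U).
Proof.
case/set0Pn=> M0 sM0.
have [//|M N sM sN|M sM topM] := @join_closed_max (fun M => M \in stables T U) M0 sM0.
  by have [] := join_stable hT sU sM sN.
rewrite /side_opt; case: pickP => [N|/(_ M)] /=.
  case/andP=> sN /forall_inP topN; split=> // L sL.
  by apply/side_leP; rewrite ?stables_matching ?topN.
rewrite sM; move/negP; case; apply/forall_inP => N sN.
by apply/side_leP; rewrite ?stables_matching //; apply: topM.
Qed.

Lemma stables_join_closed : join_closed T X (stables T U).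
Proof.
by apply/forall_inP=> M sM; apply/forall_inP=> N sN; case: (join_stable hT sU sM sN).
Qed.

Lemma stables_internally_stable : internally_stable T (stables T U).
Proof.
apply/forall_inP=> M sM; apply/forall_inP=> N sN.
by apply/(blocksE (T := T)); rewrite ?stables_matching //; apply: stables_unblocked.
Qed.

End Table.

Lemma lower_setC M N : lower T (~: X) M N <->
  forall y, y \notin X -> mscore T M y <= mscore T N y.
Proof. by split=> h y yX; apply: h; move: yX; rewrite inE. Qed.

End StableLattice.

(** * Internal stability versus join-closure with opposition of interests *)

Section InternalStability.
Variables (A : finType) (T : roommate A) (X : {set A}).
Hypothesis hT : marriage T X.
Implicit Types (x y : A) (U V M N L : {set {set A}}) (F G : {set {set {set A}}}).

Lemma stables_opposition U : U \subset edges T -> opposition T X (stables T U).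
Proof.
move=> sU; apply/forall_inP=> M sM; apply/forall_inP=> N sN.
have mM := stables_matching sU sM; have mN := stables_matching sU sN.
apply/eqP; apply/idP/idP => /side_leP h; apply/side_leP => //.
  by apply/lower_setC => y; apply: (stable_opposite hT sU sN sM); apply: h.
move=> x xX; apply: (stable_opposite (marriage_setC hT) sU sM sN); last by rewrite !inE xX.
exact: h.
Qed.

Lemma join_opposition_internally_stable G :
  G \subset matchings (edges T) -> join_closed T X G -> opposition T X G ->
  internally_stable T G.
Proof.
move=> /subsetP mG /forall_inP jG /forall_inP oG.
apply/forall_inP => M MG; apply/forall_inP => M' M'G.
have mM := mG _ MG; have mM' := mG _ M'G.
have JG : join T X M M' \in G by have /forall_inP := jG _ MG; apply.
have mJ := mG _ JG; apply/(blocksE (T := T)) => //.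
apply: (unblocked_intro hT); first by case/setIdP: mM'.
move=> x y xX yX xy.
rewrite leqNgt; case: ltnP => //= lt.
have xyJ : [set x; y] \in join T X M M'.
  by rewrite in_join // xy (mscore_edge mM' xy) (ltnW lt) orbT.
have le : side_le T X M (join T X M M').
  apply/side_leP => // u uX.
  have [v|] := boolP (0 < mscore T M u); last by rewrite -eqn0Ngt => /eqP->.
  have [{}v uv] := mscore_gt0 mM v.
  have [le|/ltnW le] := leqP (mscore T M' u) (mscore T M u).
    rewrite (mscore_edge mM uv) (@mscore_edge _ _ _ mJ u v) // in_join ?uv ?le //.
    by rewrite (matching_side hT mM uv) uX.
  have pos : 0 < mscore T M' u by apply: leq_trans le; apply: mscore_edge_gt0 uv.
  have [{}v {}uv] := mscore_gt0 mM' pos.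
  apply: (leq_trans le).
  rewrite (mscore_edge mM' uv) (@mscore_edge _ _ _ mJ u v) // in_join ?uv ?le ?orbT //.
  by rewrite (matching_side hT mM' uv) uX.
have /forall_inP/(_ _ MG)/eqP := oG _ JG; rewrite le => /esym/side_leP-/(_ mJ mM)/lower_setC.
by move/(_ y yX); rewrite (mscore_edge_sym mJ xyJ).
Qed.

Lemma internally_stable_sub_stables G :
  G \subset matchings (edges T) -> internally_stable T G ->
  cover G \subset edges T /\ G \subset stables T (cover G).
Proof.
move=> /subsetP mG /forall_inP iG.
have sV : cover G \subset edges T.
  by apply/bigcupsP => M /mG; rewrite inE => /andP[].
split=> //; apply/subsetP => M MG; apply/stablesP => //; split; first exact: mG.
  exact: bigcup_sup.
move=> a b /bigcupP[N NG ab]; move: a b ab; apply/(blocksE (T := T)); rewrite ?mG //.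
by have /forall_inP := iG _ MG; apply.
Qed.

Lemma internally_closed_iff F :
  internally_closed T F <->
  maxset (fun G : {set {set {set A}}} =>
    [&& G \subset matchings (edges T), join_closed T X G & opposition T X G]) F.
Proof.
have good U : U \subset edges T ->
    [/\ stables T U \subset matchings (edges T), join_closed T X (stables T U)
      & opposition T X (stables T U)].
  move=> sU; split; [|exact: stables_join_closed|exact: stables_opposition].
  by apply/subsetP=> M /(stables_matching sU).
split=> /maxsetP[].
  move=> /andP[mF iF] maxF; have [sV sF] := internally_stable_sub_stables mF iF.
  have [m j o] := good _ sV.
  have e := maxF _ (introT andP (conj m (stables_internally_stable sV))) sF.
  apply/maxsetP; split; first by rewrite -e m j o.
  move=> G /and3P[mG jG oG] sFG; apply: maxF => //.
  by rewrite mG join_opposition_internally_stable.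
move=> /and3P[mF jF oF] maxF; apply/maxsetP; split.
  by rewrite mF join_opposition_internally_stable.
move=> G /andP[mG iG] sFG; have [sV sG] := internally_stable_sub_stables mG iG.
have [m j o] := good _ sV.
have e := maxF _ (introT and3P (And3 m j o)) (subset_trans sFG sG).
by apply/eqP; rewrite eqEsubset sFG -e sG.
Qed.

End InternalStability.

(** * Rotations *)

Lemma uniq_map_inj_in (T1 T2 : eqType) (f : T1 -> T2) (s : seq T1) :
  uniq (map f s) -> {in s &, injective f}.
Proof.
elim: s => [|a s IH] //= /andP[fa us] u v; rewrite !inE.
case/predU1P=> [->|us']; case/predU1P=> [->|vs'] //.
- by move=> e; move: fa; rewrite e map_f.
- by move=> e; move: fa; rewrite -e map_f.
- exact: IH.
Qed.

Section Cycles.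
Variable A : finType.

(** The map need not be injective, so [a] may lie on a tail; the cycle is the orbit of the iterate
    [b] at which the trajectory of [a] closes up. *)
Lemma exists_fcycle (f : A -> A) (S : {pred A}) (a : A) : a \in S ->
  (forall b, b \in S -> f b \in S) ->
  exists c, [/\ c != [::], uniq c, fcycle f c & {subset c <= S}].
Proof.
move=> aS fS; have itS i b : b \in S -> iter i f b \in S.
  by move=> bS; elim: i => //= i; apply: fS.
have /trajectP[i lt_i e] := looping_order f a.
set b := iter i f a in e; exists (orbit f b).
have bb : iter (order f a - i) f b = b by rewrite -iterD subnK ?e // ltnW.
split; rewrite ?orbit_uniq //.
- by rewrite -size_eq0 size_orbit -lt0n order_gt0.
- apply/(orbitPcycle 0 3); exists (order f a - i).-1.
  by rewrite prednK ?subn_gt0.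
- move=> c; rewrite -fconnect_orbit => /iter_findex <-.
  exact/itS/itS.
Qed.

Lemma exists_ucycle (D : rel A) (S : {pred A}) (a : A) : a \in S ->
  (forall b, b \in S -> exists2 c, c \in S & D b c) ->
  exists2 c, ucycle D c & c != [::].
Proof.
move=> aS succ; pose f b := odflt b [pick c | (c \in S) && D b c].
have fP b : b \in S -> (f b \in S) /\ D b (f b).
  rewrite /f => /succ[c cS bc]; case: pickP => [d /andP[]|/(_ c)] //=.
  by rewrite cS bc.
have [c [c0 uc cc cS]] := exists_fcycle aS (fun b bS => (fP b bS).1).
exists c => //; apply/andP; split=> //; apply: cycle_from_next => // b bc.
by rewrite (nextE cc bc); apply: (fP _ _).2; apply: cS.
Qed.

Lemma cycle_ind_next (B : finType) (s : seq B) (P : B -> Prop) : uniq s ->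
  (forall p, p \in s -> P p -> P (next s p)) ->
  forall p q, p \in s -> q \in s -> P p -> P q.
Proof.
move=> us step p q ps qs Pp.
have: fconnect (next s) p q by rewrite (fconnect_cycle (cycle_next us) ps).
move/iter_findex <-; elim: (findex _ _ _) => //= n IH; apply: step => //.
by elim: n {IH} => //= n; rewrite mem_next.
Qed.

(** The representative picked by the quotient is known only up to a cyclic shift. *)
Lemma rot_seq_pi (s : seq (A * A)) : exists i, rot_seq (\pi_(rotation A) s)%qT = rot i s.
Proof.
apply/shift_eqP; rewrite -(eqquotE (rotation A)) /rot_seq reprK.
exact: eqxx.
Qed.

(** Both sequences are cycles of the successor map of r through a common pair, hence shifts of the
    same orbit. Inclusion of q in r thus already gives equality. *)
Lemma rotation_eq (r q : rotation A) : uniq (rot_seq r) -> uniq (rot_seq q) ->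
  rot_seq q != [::] ->
  (forall p, p \in rot_seq q ->
     p \in rot_seq r /\ next (rot_seq r) p = next (rot_seq q) p) -> q = r.
Proof.
move=> ur uq q0 h; case E: (rot_seq q) q0 => [//|p s'] _.
have pq : p \in rot_seq q by rewrite E mem_head.
have [pr _] := h p pq.
have cq : fcycle (next (rot_seq r)) (rot_seq q).
  by apply: cycle_from_next => // p' /h[_ e]; apply/eqP.
have [i ei] := orbit_rot_cycle cq uq pq.
have [j ej] := orbit_rot_cycle (cycle_next ur) ur pr.
have : shift_eq (rot_seq q) (rot_seq r).
  apply: (@shift_eq_trans _ (rot i (rot_seq q))); first by apply/shift_eqP; exists i.
  by rewrite shift_eq_sym -ei ej; apply/shift_eqP; exists j.
by rewrite -(eqquotE (rotation A)) /rot_seq !reprK => /eqP.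
Qed.

End Cycles.

Section Rotate.
Variables (A : finType) (T : roommate A) (X : {set A}).
Implicit Types (U M : {set {set A}}) (s : seq (A * A)).

Lemma gen_exposed_seq_rot U M s i :
  gen_exposed_seq T X U M (rot i s) = gen_exposed_seq T X U M s.
Proof.
rewrite /gen_exposed_seq rot_cycle -!size_eq0 size_rot /unzip1 /unzip2 !map_rot.
have -> : uniq (rot i [seq p.1 | p <- s] ++ rot i [seq p.2 | p <- s])
    = uniq ([seq p.1 | p <- s] ++ [seq p.2 | p <- s]).
  by apply: perm_uniq; apply: perm_cat; rewrite perm_rot.
by congr [&& _, _, _ & _]; apply: eq_all_r => p; rewrite mem_rot.
Qed.

Lemma gen_exposed_facts U M (r : rotation A) : gen_exposed T X U M r ->
  [/\ uniq (rot_seq r), rot_seq r != [::],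
      {in rot_seq r &, injective fst}, {in rot_seq r &, injective snd}
    & forall p, p \in rot_seq r -> let p' := next (rot_seq r) p in
      [/\ p.1 \in X, p.2 \notin X & [set p.1; p.2] \in M] /\
      [/\ [set p.1; p'.2] \in U, pref T p'.2 p.1 p'.1 & pref T p.1 p.2 p'.2]].
Proof.
case/and4P=> s0 us /allP sM cs; move: us; rewrite cat_uniq => /and3P[u1 _ u2].
have us := map_uniq u1.
split=> //; [exact: uniq_map_inj_in | exact: uniq_map_inj_in |].
by move=> p ps /=; split; apply/and3P; [apply: sM | apply: (next_cycle cs)].
Qed.

End Rotate.

(** * Generalized rotations and their elimination *)

Section Elimination.
Variables (A : finType) (T : roommate A) (X : {set A}).
Hypothesis hT : marriage T X.
Implicit Types (x y z : A) (U M N : {set {set A}}) (r q : rotation A).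

Lemma pref_scoreE z a b : acc T z a -> acc T z b ->
  pref T z a b = (score T z (Some b) < score T z (Some a)).
Proof. by move=> za zb; rewrite -opref_score. Qed.

(** The only source of new rotations: [g] sends an agent to the one whose M-partner it would take
    over, and the iterates of [g] inside the finite set [C] close up to a cycle. *)
Lemma rotation_intro U M (C : {pred A}) (g : A -> A) x0 :
  M \in matchings (edges T) -> x0 \in C ->
  (forall x, x \in C -> [/\ x \in X, mate M x \notin X & [set x; mate M x] \in M]) ->
  (forall x, x \in C -> [/\ g x \in C, [set x; mate M (g x)] \in U,
     pref T (mate M (g x)) x (g x) & pref T x (mate M x) (mate M (g x))]) ->
  exists2 r, gen_exposed T X U M r &
    forall p, p \in rot_seq r ->
      [/\ p.1 \in C, p.2 = mate M p.1
        & next (rot_seq r) p = (g p.1, mate M (g p.1))].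
Proof.
move=> mM x0C CM Cg.
have [c [c0 uc cc cC]] := exists_fcycle x0C (fun x xC => let: And4 h _ _ _ := Cg x xC in h).
pose h x := (x, mate M x).
have hinj : injective h by move=> x y [].
have uhc : uniq (map h c) by rewrite map_inj_uniq.
have nexth p : p \in map h c -> next (map h c) p = (g p.1, mate M (g p.1)).
  by case/mapP=> x xc ->; rewrite (next_map hinj) // (nextE cc xc).
have gen : gen_exposed_seq T X U M (map h c).
  apply/and4P; split.
  - by case: (c) c0.
  - rewrite /unzip1 /unzip2 -!map_comp cat_uniq.
    rewrite (map_inj_uniq (f := fst \o h)) ?uc //=.
    rewrite (map_inj_uniq (mate_inj mM)) uc andbT.
    apply/hasPn => _ /mapP[x /cC/CM[_ yX _] ->].
    by apply: contra yX => /mapP[z /cC/CM[zX _ _] /= ->].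
  - apply/allP => _ /mapP[x /cC/CM[xX yX xy] ->] /=; exact/and3P.
  - apply: cycle_from_next => // p pc; rewrite nexth //.
    case/mapP: pc => x /cC/Cg[_ ? ? ?] -> /=; exact/and3P.
have [i ei] := rot_seq_pi (map h c).
exists (\pi_(rotation A) (map h c))%qT.
  by rewrite /gen_exposed ei gen_exposed_seq_rot.
rewrite ei => p; rewrite mem_rot next_rot // => pc; split; last exact: nexth.
  by case/mapP: pc => x /cC xC ->.
by case/mapP: pc => x _ ->.
Qed.

Section Elim.
Variables (U M : {set {set A}}) (r : rotation A).
Hypotheses (sU : U \subset edges T) (mM : M \in matchings (edges T)).
Hypothesis ex : gen_exposed T X U M r.
Let s := rot_seq r.
Let N := elim M r.

Lemma exposed_pair p : p \in s ->
  [/\ p.1 \in X, p.2 \notin X & [set p.1; p.2] \in M].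
Proof. by move=> ps; have [_ _ _ _ /(_ p ps)[]] := gen_exposed_facts ex. Qed.

Lemma exposed_mscore p : p \in s -> mscore T M p.1 = score T p.1 (Some p.2).
Proof. by case/exposed_pair=> _ _; apply: mscore_edge. Qed.

Lemma exposed_next p : p \in s ->
  [/\ (next s p).2 \notin X, [set p.1; (next s p).2] \in U,
    score T (next s p).2 (Some (next s p).1) < score T (next s p).2 (Some p.1)
   & score T p.1 (Some (next s p).2) < score T p.1 (Some p.2)].
Proof.
move=> ps; have [_ _ _ _ /(_ p ps)/=[_ [pU p1 p2]]] := gen_exposed_facts ex.
have ps' : next s p \in s by rewrite mem_next.
have [_ pX' pM'] := exposed_pair ps'; have [_ _ pM] := exposed_pair ps.
have acc' : acc T p.1 (next s p).2 by rewrite -edgesE (subsetP sU).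
split=> //; rewrite -pref_scoreE // ?(matching_acc mM pM) // acc_sym //.
exact: matching_acc mM _ _ pM'.
Qed.

Lemma in_elim x y : x \in X -> y \notin X ->
  ([set x; y] \in N) =
  if x \in unzip1 s then has (fun p => (p.1 == x) && ((next s p).2 == y)) s
  else [set x; y] \in M.
Proof.
move=> xX yX; rewrite /N /elim !inE.
have old : ([set x; y] \in rot_old r) = ((x, y) \in s).
  apply/imsetP/idP => [[p ps]|xys]; last by exists (x, y).
  have [pX pX' _] := exposed_pair ps.
  by case/(set2_side xX yX pX pX') => -> ->; rewrite -surjective_pairing.
have new : ([set x; y] \in rot_new r) = has (fun p => (p.1 == x) && ((next s p).2 == y)) s.
  apply/imsetP/hasP => [[p ps]|[p ps /andP[/eqP <- /eqP <-]]]; last by exists p.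
  have [pX _ _] := exposed_pair ps; have [pX' _ _ _] := exposed_next ps.
  by case/(set2_side xX yX pX pX') => -> ->; exists p => //; rewrite !eqxx.
rewrite old new; case: ifPn => [/mapP[p ps ->]|xs].
  case: (boolP (_ \in M)) => [pyM|]; rewrite ?andbF //.
  have [_ _ pM] := exposed_pair ps.
  by rewrite (matching_uniq mM pyM pM) -surjective_pairing ps.
have -> : (x, y) \notin s by apply: contra xs => /(map_f fst).
rewrite [X in _ || X]negbTE ?orbF //.
by apply: contra xs => /hasP[p ps /andP[/eqP <- _]]; apply: map_f.
Qed.

Lemma elim_sub : N \subset M :|: U.
Proof.
apply/subsetP => e; rewrite !inE => /orP[/andP[_ ->]//|/imsetP[p ps ->]].
by have [_ -> _ _] := exposed_next ps; rewrite orbT.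
Qed.

Lemma elim_new p : p \in s -> [set p.1; (next s p).2] \in N.
Proof. by move=> ps; rewrite !inE; apply/orP; right; apply/imsetP; exists p. Qed.

Lemma elim_matching : N \in matchings (edges T).
Proof.
have [us _ i1 i2 _] := gen_exposed_facts ex.
have sN : N \subset edges T.
  apply: subset_trans elim_sub _; rewrite subUset sU andbT.
  by move: mM; rewrite inE => /andP[].
have side x y : x \in X -> [set x; y] \in N -> y \notin X.
  by move=> xX /(subsetP sN); rewrite edgesE => /(acc_side hT) ->; rewrite xX.
have ninj (p q : A * A) : p \in s -> q \in s -> (next s p).2 = (next s q).2 -> p = q.
  move=> ps qs e; apply: (can_inj (prev_next us)); apply: i2 => //; by rewrite mem_next.
apply: (matchings_intro hT sN) => [x y y' xX xy xy'|x x' y xX x'X yX].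
  have yX := side _ _ xX xy; have yX' := side _ _ xX xy'.
  move: xy xy'; rewrite !in_elim //; case: ifP => [_|_]; last exact: (matching_uniq mM).
  move=> /hasP[p ps /andP[/eqP px /eqP <-]] /hasP[q qs /andP[/eqP qx /eqP <-]].
  by have -> : p = q by apply: i1; rewrite // px qx.
rewrite !in_elim //.
(* An agent taken over by the rotation is the old partner of the next pair, so its M-partner cannot
   lie outside the rotation. *)
have clash u v : u \notin unzip1 s -> [set u; y] \in M ->
    has (fun p => (p.1 == v) && ((next s p).2 == y)) s -> False.
  move=> us' uy /hasP[p ps /andP[_ /eqP e]].
  have ps' : next s p \in s by rewrite mem_next.
  have [_ _ pM] := exposed_pair ps'; rewrite e setUC in pM; rewrite setUC in uy.
  by move: us'; rewrite (matching_uniq mM uy pM) map_f.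
case: ifPn => xs; case: ifPn => xs'.
- move=> /hasP[p ps /andP[/eqP <- /eqP e]] /hasP[q qs /andP[/eqP <- /eqP e']].
  by rewrite (ninj p q) // e e'.
- by move=> h1 h2; case: (clash _ _ xs' h2 h1).
- by move=> h1 h2; case: (clash _ _ xs h1 h2).
- by rewrite setUC => xy; rewrite setUC; apply: (matching_uniq mM xy).
Qed.

Lemma elim_mscore p : p \in s -> mscore T N p.1 = score T p.1 (Some (next s p).2).
Proof. by move/elim_new; apply: (mscore_edge elim_matching). Qed.

Lemma elim_lt p : p \in s -> mscore T N p.1 < mscore T M p.1.
Proof.
by move=> ps; rewrite elim_mscore // exposed_mscore //; case: (exposed_next ps).
Qed.

Lemma elim_unchanged x : x \in X -> x \notin unzip1 s -> mscore T N x = mscore T M x.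
Proof.
move=> xX xs; congr score.
have h y : ([set x; y] \in N) = ([set x; y] \in M).
  case yX: (y \in X); last by rewrite in_elim ?yX // (negbTE xs).
  apply/idP/idP => [/(matching_side hT elim_matching)|/(matching_side hT mM)];
    by rewrite yX xX.
by rewrite /partner; apply: eq_pick => y; apply: h.
Qed.

Lemma elim_lower : lower T X N M.
Proof.
move=> x xX; case: (boolP (x \in unzip1 s)) => [/mapP[p ps ->]|xs].
  exact/ltnW/elim_lt.
by rewrite elim_unchanged.
Qed.

Lemma elim_changed x : x \in X -> mscore T N x < mscore T M x ->
  exists2 p, p \in s & x = p.1.
Proof.
move=> xX; case: (boolP (x \in unzip1 s)) => [/mapP[p ps ->]|xs]; first by exists p.
by rewrite elim_unchanged // ltnn.
Qed.

Lemma elim_upper y : y \notin X -> mscore T M y <= mscore T N y.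
Proof.
move=> yX; have [us _ _ _ _] := gen_exposed_facts ex.
case: (posnP (mscore T M y)) => [-> //|/(mscore_gt0 mM)[x yx]].
have xX : x \in X by rewrite (matching_side hT mM yx).
case: (boolP (x \in unzip1 s)) => [/mapP[q qs xq]|xs]; last first.
  rewrite (mscore_edge mM yx) (@mscore_edge _ _ _ elim_matching y x) //.
  by rewrite setUC in_elim // (negbTE xs) setUC.
(* The new partner of q.2 is the X-agent of the pair preceding q, which q.2 prefers by exposure. *)
have eq : next s (prev s q) = q by rewrite next_prev.
have ps : prev s q \in s by rewrite mem_prev.
have [_ _ qM] := exposed_pair qs.
have yq : y = q.2 by rewrite setUC xq in yx; apply: (matching_uniq mM yx qM).
have := elim_new ps; rewrite eq -yq => pN.
rewrite (mscore_edge mM yx) (mscore_edge_sym elim_matching pN).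
by have [_ _ /ltnW + _] := exposed_next ps; rewrite eq -yq -xq.
Qed.

Lemma elim_neq : N != M.
Proof.
apply/eqP => e; have [_ + _ _ _] := gen_exposed_facts ex.
rewrite -/s; case E: s => [//|p s'] _.
by have := @elim_lt p; rewrite e E mem_head ltnn => /(_ isT).
Qed.

End Elim.
End Elimination.

(** * Classical rotations and chains of stable matchings *)

Section Classical.
Variables (A : finType) (T : roommate A) (X : {set A}).
Hypothesis hT : marriage T X.
Variable U : {set {set A}}.
Hypothesis sU : U \subset edges T.
Implicit Types (x y z : A) (M N L : {set {set A}}) (r q : rotation A).

Lemma stables_no_block M x y : M \in stables T U -> [set x; y] \in U ->
  (score T x (Some y) <= mscore T M x) || (score T y (Some x) <= mscore T M y).
Proof. by case/(stablesP _ sU) => _ _; apply. Qed.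

Lemma exposed_gen M r : exposed T X U M r -> gen_exposed T X U M r.
Proof. by case/and3P. Qed.

Lemma exposed_in_stables M r : exposed T X U M r -> M \in stables T U.
Proof. by case/and3P. Qed.

Lemma exposed_matching M r : exposed T X U M r -> M \in matchings (edges T).
Proof. by move/exposed_in_stables; apply: stables_matching. Qed.

Lemma acc_of_table x y : [set x; y] \in U -> acc T x y.
Proof. by move/(subsetP sU); rewrite edgesE. Qed.

Lemma exposed_between M r p y : exposed T X U M r -> p \in rot_seq r ->
  [set p.1; y] \in U -> mscore T (elim M r) p.1 < score T p.1 (Some y) ->
  score T p.1 (Some y) < mscore T M p.1 -> score T y (Some p.1) < mscore T M y.
Proof.
move=> ex ps py; have gex := exposed_gen ex; have mM := exposed_matching ex.
have [_ _ pM] := exposed_pair gex ps; have [_ pU' _ _] := exposed_next sU mM gex ps.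
rewrite (elim_mscore hT sU mM gex ps) (exposed_mscore mM gex ps).
have py' := acc_of_table py.
rewrite -!(pref_scoreE (T := T)) ?(matching_acc mM pM) ?acc_of_table // => h1 h2.
case/and3P: ex => _ _ /next_cycle-/(_ _ ps)/forallP/(_ y).
rewrite py h1 h2 implyTb opref_score; [by [] | exact: partner_ok | by rewrite /= acc_sym].
Qed.

(** Agents outside X only gain, so at the y-end an edge blocking M/r would also block M. Stability
    of M then makes x an agent of the rotation with y strictly between its old and new partners,
    which the classical condition rules out. *)
Lemma elim_stable M r : exposed T X U M r -> elim M r \in stables T U.
Proof.
move=> ex; have gex := exposed_gen ex; have sM := exposed_in_stables ex.
have mM := exposed_matching ex.
apply/stablesP => //; split; first exact: (elim_matching hT sU mM gex).
  apply: subset_trans (elim_sub sU mM gex) _; rewrite subUset subxx andbT.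
  exact: (stables_subset sU sM).
apply: (unblocked_intro hT sU) => x y xX yX xy.
apply/negPn/negP; rewrite negb_or -!ltnNge => /andP[ltx lty].
have upy := elim_upper hT sU mM gex yX.
have lty' := leq_ltn_trans upy lty.
have := stables_no_block sM xy; rewrite [X in _ || X]leqNgt lty' orbF.
rewrite leq_eqVlt => /orP[/eqP e|ltM].
  have xyM := edge_of_score mM (acc_of_table xy) (esym e).
  by move: lty'; rewrite (mscore_edge_sym mM xyM) ltnn.
have [p ps xp] := elim_changed hT sU mM gex xX (ltn_trans ltx ltM).
rewrite xp in xy ltx ltM lty'; have := exposed_between ex ps xy ltx ltM.
by rewrite ltnNge ltnW.
Qed.

(* The median of L, M/r and M is M or M/r, since M covers M/r. *)
Lemma rotation_dichotomy M r L : exposed T X U M r -> L \in stables T U ->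
  ((forall x, x \in X -> mscore T (elim M r) x < mscore T M x ->
      mscore T M x <= mscore T L x) /\
   (forall y, y \notin X -> mscore T M y < mscore T (elim M r) y ->
      mscore T L y <= mscore T M y)) \/
  ((forall x, x \in X -> mscore T (elim M r) x < mscore T M x ->
      mscore T L x <= mscore T (elim M r) x) /\
   (forall y, y \notin X -> mscore T M y < mscore T (elim M r) y ->
      mscore T (elim M r) y <= mscore T L y)).
Proof.
move=> ex sL; have gex := exposed_gen ex; have sM := exposed_in_stables ex.
have mM := exposed_matching ex; have sN := elim_stable ex.
have mN := stables_matching sU sN; set N := elim M r in sN mN *.
have [K [sK Kx Ky]] := median_stable hT sU sL sN sM.
have mK := stables_matching sU sK.
have lowN : lower T X N M := elim_lower hT sU mM gex.
have KM : lower T X K M by move=> x xX; rewrite Kx // geq_minr.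
have NK x : x \in X -> mscore T N x <= mscore T K x.
  by move=> xX; rewrite Kx // leq_min lowN // leq_maxr.
(* A partner strictly between the two values is excluded: by [exposed_between] it would strictly
   prefer M to K, whereas K lies below M for X. *)
have two p : p \in rot_seq r ->
    mscore T K p.1 = mscore T M p.1 \/ mscore T K p.1 = mscore T N p.1.
  move=> ps; have [pX _ _] := exposed_pair gex ps.
  have := KM _ pX; rewrite leq_eqVlt => /orP[/eqP->|ltM]; first by left.
  have := NK _ pX; rewrite leq_eqVlt => /orP[/eqP->|ltN]; first by right.
  have [y py] := mscore_gt0 mK (leq_ltn_trans (leq0n _) ltN).
  have pyU := subsetP (stables_subset sU sK) _ py.
  rewrite (mscore_edge mK py) in ltM ltN.
  have := exposed_between ex ps pyU ltN ltM; rewrite -(mscore_edge_sym mK py).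
  rewrite ltnNge (stable_opposite hT sU sK sM KM) //.
  by rewrite (matching_side hT mK py) pX.
have [us _ i1 _ _] := gen_exposed_facts gex.
(* An X-agent at its new value holds the old partner of the next X-agent, which must then move too.
   So the whole cycle moves as soon as one agent does. *)
have stepP p : p \in rot_seq r -> mscore T K p.1 = mscore T N p.1 ->
    mscore T K (next (rot_seq r) p).1 = mscore T N (next (rot_seq r) p).1.
  move=> ps e; have ps' : next (rot_seq r) p \in rot_seq r by rewrite mem_next.
  case: (two _ ps') => // e'.
  have [_ _ pM'] := exposed_pair gex ps'.
  have [_ pU _ lt] := exposed_next sU mM gex ps.
  have h1 : [set p.1; (next (rot_seq r) p).2] \in K.
    apply: (edge_of_score mK (acc_of_table pU)).
    by rewrite e (elim_mscore hT sU mM gex ps).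
  have h2 : [set (next (rot_seq r) p).1; (next (rot_seq r) p).2] \in K.
    apply: (edge_of_score mK (matching_acc mM pM')).
    by rewrite e' (mscore_edge mM pM').
  rewrite setUC in h1; rewrite setUC in h2.
  have /(i1 _ _ ps ps') pe := matching_uniq mK h1 h2.
  by move: lt; rewrite -pe ltnn.
have [/existsP|] := boolP [exists p, (p \in rot_seq r) && (mscore T K p.1 == mscore T N p.1)].
  case=> p /andP[ps /eqP e]; right.
  have allN (q : A * A) : q \in rot_seq r -> mscore T K q.1 = mscore T N q.1.
    by move=> qs; apply: (cycle_ind_next us stepP ps qs).
  have eKN : K = N.
    apply: (matching_eq hT mK mN) => x xX; move: (KM _ xX) (NK _ xX).
    case: (boolP (x \in unzip1 (rot_seq r))) => [/mapP[q qs ->] _ _|xs]; first exact: allN.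
    by rewrite (elim_unchanged hT sU mM gex xX xs); clear; lia.
  split=> z zX lt; [have := Kx _ zX | have := Ky _ zX];
    by rewrite eKN; move: lt; clear; lia.
rewrite negb_exists => /forallP allM; left.
have eKM : K = M.
  apply: (matching_eq hT mK mM) => x xX; move: (KM _ xX) (NK _ xX).
  case: (boolP (x \in unzip1 (rot_seq r))) => [/mapP[q qs ->] _ _|xs].
    by case: (two _ qs) => // /eqP; have := allM q; rewrite qs /= => /negPf ->.
  by rewrite (elim_unchanged hT sU mM gex xX xs); clear; lia.
split=> z zX lt; [have := Kx _ zX | have := Ky _ zX];
  by rewrite eKM; move: lt; clear; lia.
Qed.

(** For x losing from M to L, [h x] is the best agent below its M-partner that would accept x over
    its own M-partner. The partner of x in L is a candidate, so [h x] is at least as good as it,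
    which keeps M/r above L; maximality of [h x] gives the classical condition. *)
Lemma exists_rotation M L : M \in stables T U -> L \in stables T U ->
  lower T X L M -> L != M ->
  exists2 r, exposed T X U M r & lower T X L (elim M r).
Proof.
move=> sM sL lowL neqL.
have mM := stables_matching sU sM; have mL := stables_matching sU sL.
have uML := stables_unblocked sU sM sL; have uLM := stables_unblocked sU sL sM.
pose C := [pred x | (x \in X) && (mscore T L x < mscore T M x)].
have [x0 x0C] : exists x, x \in C.
  apply/existsP; apply: contraR neqL; rewrite negb_exists => /forallP h.
  apply/eqP/(matching_eq hT mL mM) => x xX; apply/eqP; rewrite eqn_leq lowL //=.
  by have := h x; rewrite inE xX /= -leqNgt.
pose cand x y := [&& [set x; y] \in U, mscore T M y < score T y (Some x)
                   & score T x (Some y) < mscore T M x].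
pose best x y := cand x y &&
  [forall y', cand x y' ==> (score T x (Some y') <= score T x (Some y))].
pose h x := odflt x [pick y | best x y].
have hP x : x \in C -> [/\ cand x (h x), mscore T L x <= score T x (Some (h x))
    & forall y, cand x y -> score T x (Some y) <= score T x (Some (h x))].
  rewrite inE => /andP[xX lt].
  have [y xy lty] := prefers_decomposition mM mL uML uLM lt.
  have cy : cand x y.
    rewrite /cand (subsetP (stables_subset sU sL)) //= -(mscore_edge mL xy).
    by rewrite -(mscore_edge_sym mL xy) lty.
  rewrite /h; case: pickP => [z /andP[cz /forallP maxz]|/=].
    have maxz' y' : cand x y' -> score T x (Some y') <= score T x (Some z).
      exact/implyP/maxz.
    by rewrite /= cz (mscore_edge mL xy) maxz'.
  have [z cz maxz] := @arg_maxnP _ y (cand x) (fun y => score T x (Some y)) cy.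
  move/(_ z); rewrite /best cz /= => /negP[].
  by apply/forallP => y'; apply/implyP; apply: maxz.
pose g x := mate M (h x).
(* Since the edge from x to [h x] does not block L, [h x] strictly gains from M to L; its M-partner
   [g x] therefore loses and is again in [C]. *)
have gP x : x \in C -> g x \in C /\ [set h x; g x] \in M.
  move=> xC; have [/and3P[xh ltM ltx] leL _] := hP x xC.
  have xX : x \in X by case/andP: xC.
  have lth : mscore T M (h x) < mscore T L (h x).
    case/orP: (stables_no_block sL xh) => [leL'|]; last exact: leq_trans.
    have e : mscore T L x = score T x (Some (h x)) by apply/eqP; rewrite eqn_leq leL.
    by rewrite (mscore_edge_sym mL (edge_of_score mL (acc_of_table xh) e)).
  have [b hb ltb] := prefers_decomposition mL mM uLM uML lth.
  rewrite /g /mate (partner_Some mM hb) /= hb inE ltb andbT.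
  by rewrite (matching_side hT mM hb) (acc_side hT (acc_of_table xh)) xX.
have mg x : x \in C -> mate M (g x) = h x.
  by case/gP=> _; rewrite setUC /mate => /(partner_Some mM) ->.
have mCM x : x \in C -> [/\ x \in X, mate M x \notin X & [set x; mate M x] \in M].
  case/andP=> xX lt; have [y xy] := mscore_gt0 mM (leq_ltn_trans (leq0n _) lt).
  by rewrite /mate (partner_Some mM xy) /= xX xy (matching_side hT mM xy) xX.
have [r gex rP] : exists2 r, gen_exposed T X U M r & forall p, p \in rot_seq r ->
    [/\ p.1 \in C, p.2 = mate M p.1 & next (rot_seq r) p = (g p.1, mate M (g p.1))].
  apply: (rotation_intro mM x0C mCM) => x xC; have [/and3P[xh ltM ltx] _ _] := hP x xC.
  have [gC hg] := gP x xC; have [xX yX xy] := mCM x xC; rewrite mg //.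
  have accx := acc_of_table xh; have accy := matching_acc mM xy.
  have acch := matching_acc mM hg.
  split=> //; rewrite pref_scoreE //; last by rewrite -(mscore_edge mM xy).
    by rewrite -(mscore_edge mM hg).
  by rewrite acc_sym.
have nx p : p \in rot_seq r -> (next (rot_seq r) p).2 = h p.1.
  by move=> /rP[pC _ ->]; rewrite /= mg.
exists r; last first.
  move=> x xX; case: (boolP (x \in unzip1 (rot_seq r))) => [/mapP[p ps ->]|xs].
    rewrite (elim_mscore hT sU mM gex ps) nx //.
    by have [pC _ _] := rP _ ps; have [] := hP _ pC.
  by rewrite (elim_unchanged hT sU mM gex xX xs) lowL.
have [us _ _ _ _] := gen_exposed_facts gex.
apply/and3P; split=> //; apply: cycle_from_next => // p ps.
apply/forallP => y; apply/implyP => /and3P[py]; have [pC p2 _] := rP _ ps.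
rewrite nx // p2; have [/and3P[ph _ _] _ maxh] := hP _ pC; have [pX _ pM] := mCM _ pC.
have accy := acc_of_table py; have acch := acc_of_table ph.
have accm := matching_acc mM pM.
rewrite !pref_scoreE // => lt1 lt2; rewrite opref_score ?partner_ok //=; last by rewrite acc_sym.
have lt1' : score T p.1 (Some y) < mscore T M p.1 by rewrite (mscore_edge mM pM).
(* If y preferred p.1 to its M-partner, it would be a candidate better than [h p.1]; a tie would
   make y the M-partner of p.1. *)
rewrite ltnNge leq_eqVlt negb_or; apply/andP; split; last first.
  by apply/negP => lt3; have := maxh y; rewrite /cand py lt3 lt1' leqNgt lt2 => /(_ isT).
apply/eqP => e; have yp : [set y; p.1] \in M.
  by apply: (edge_of_score mM) => //; rewrite acc_sym.
by move: lt1'; rewrite (mscore_edge_sym mM yp) ltnn.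
Qed.

Lemma elim_total_lt M r : exposed T X U M r ->
  \sum_(x in X) mscore T (elim M r) x < \sum_(x in X) mscore T M x.
Proof.
move=> ex; have gex := exposed_gen ex; have mM := exposed_matching ex.
have [_ + _ _ _] := gen_exposed_facts gex.
case E: (rot_seq r) => [//|p s'] _; have ps : p \in rot_seq r by rewrite E mem_head.
have [pX _ _] := exposed_pair gex ps.
rewrite (bigD1 p.1) //= [ltnRHS](bigD1 p.1) //= -addSn.
apply: leq_add; first exact: (elim_lt hT sU mM gex ps).
by apply: leq_sum => x /andP[xX _]; apply: (elim_lower hT sU mM gex).
Qed.

Lemma exists_chain M L : M \in stables T U -> L \in stables T U -> lower T X L M ->
  exists2 l, eliminable (exposed T X U) M l & foldl (@elim A) M l = L.
Proof.
have [n] := ubnP (\sum_(x in X) mscore T M x).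
elim: n M => // n IH M; rewrite ltnS => leM sM sL lowL.
have [->|neq] := eqVneq L M; first by exists [::].
have [r ex lowr] := exists_rotation sM sL lowL neq.
have [||//|//|l el fl] := IH (elim M r); last by exists (r :: l); rewrite //= ex.
  exact: leq_trans (elim_total_lt ex) leM.
exact: elim_stable.
Qed.

Lemma eliminable_stable M l : M \in stables T U -> eliminable (exposed T X U) M l ->
  foldl (@elim A) M l \in stables T U /\ lower T X (foldl (@elim A) M l) M.
Proof.
elim: l M => [|r l IH] M sM /=; first by move=> _; split=> // x.
case/andP=> ex el; have [sF lowF] := IH _ (elim_stable ex) el; split=> // x xX.
apply: leq_trans (lowF x xX) _.
exact: (elim_lower hT sU (stables_matching sU sM) (exposed_gen ex)).
Qed.

Lemma eliminable_cat ex M l l' : eliminable ex M (l ++ l') =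
  eliminable ex M l && eliminable ex (foldl (@elim A) M l) l'.
Proof. by elim: l M => //= r l IH M; rewrite IH andbA. Qed.

Lemma eliminable_mem M l q : M \in stables T U -> eliminable (exposed T X U) M l ->
  q \in l -> exists N, [/\ exposed T X U N q, lower T X N M
    & lower T X (foldl (@elim A) M l) (elim N q)].
Proof.
move=> sM el ql; case/splitPr: ql el => l1 l2; rewrite eliminable_cat => /andP[el1 /= /andP[exq el2]].
exists (foldl (@elim A) M l1); split=> //; first exact: (eliminable_stable sM el1).2.
rewrite foldl_cat /=; exact: (eliminable_stable (elim_stable exq) el2).2.
Qed.

(** Exposure of r fixes the scores of its X-agents, elimination lowers them strictly, and they never
    rise again. *)
Lemma eliminable_uniq M l : M \in stables T U -> eliminable (exposed T X U) M l -> uniq l.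
Proof.
elim: l M => //= r l IH M sM /andP[ex el]; have sN := elim_stable ex.
rewrite (IH _ sN el) andbT; apply/negP => rl.
have [N [exN lowN _]] := eliminable_mem sN el rl.
have [_ + _ _ _] := gen_exposed_facts (exposed_gen ex).
case E: (rot_seq r) => [//|p s'] _; have ps : p \in rot_seq r by rewrite E mem_head.
have [pX _ _] := exposed_pair (exposed_gen ex) ps.
have mM := exposed_matching ex; have mN := exposed_matching exN.
have := leq_ltn_trans (lowN _ pX) (elim_lt hT sU mM (exposed_gen ex) ps).
rewrite (exposed_mscore mM (exposed_gen ex) ps).
by rewrite (exposed_mscore mN (exposed_gen exN) ps) ltnn.
Qed.

End Classical.

(** * Rotations preceding a given one *)

Section Preceding.
Variables (A : finType) (T : roommate A) (X : {set A}).
Hypothesis hT : marriage T X.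
Variable U : {set {set A}}.
Hypothesis sU : U \subset edges T.
Implicit Types (x y z : A) (M N L : {set {set A}}) (r q : rotation A)
  (p : A * A) (l : seq (rotation A)).

Lemma rot_seq_exists M r : gen_exposed T X U M r -> exists p, p \in rot_seq r.
Proof.
move=> ex; have [_ + _ _ _] := gen_exposed_facts ex.
by case: (rot_seq r) => [//|p s] _; exists p; rewrite mem_head.
Qed.

(* A rotation q of U can only be crossed by eliminating q itself: by the
   dichotomy both ends of the crossing step agree with q on its agents. *)
Lemma crossing_rotation M r N q : exposed T X U M r -> exposed T X U N q ->
  (forall p, p \in rot_seq q -> mscore T N p.1 <= mscore T M p.1) ->
  (forall p, p \in rot_seq q -> mscore T (elim M r) p.1 <= mscore T (elim N q) p.1) ->
  q = r.
Proof.
move=> exM exN leM leN; have gM := exposed_gen exM; have gN := exposed_gen exN.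
have mM := exposed_matching sU exM; have mN := exposed_matching sU exN.
have [uM _ _ iM' _] := gen_exposed_facts gM.
have [uN qn0 _ _ _] := gen_exposed_facts gN.
have sN' := elim_stable hT sU exN; have sN := exposed_in_stables exN.
have lt p : p \in rot_seq q -> mscore T (elim M r) p.1 < mscore T M p.1.
  move=> pq; apply: leq_ltn_trans (leN p pq) _; apply: leq_trans (leM p pq).
  exact: (elim_lt hT sU mN gN).
have ltq p : p \in rot_seq q -> mscore T (elim N q) p.1 < mscore T N p.1.
  exact: (elim_lt hT sU mN gN).
have Xq p : p \in rot_seq q -> p.1 \in X by case/(exposed_pair gN).
have mem p : p \in rot_seq q -> p \in rot_seq r.
  move=> pq; have pX := Xq p pq; have ltp := lt p pq.
  have e : mscore T M p.1 = mscore T N p.1.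
    apply/eqP; rewrite eqn_leq leM // andbT.
    case: (rotation_dichotomy hT sU exM sN) => [] [h _]; first exact: h.
    have := leq_trans (ltq _ pq) (h _ pX ltp).
    by rewrite ltnNge leN.
  have [p' pr' ep] := elim_changed hT sU mM gM pX ltp.
  have [_ _ pN] := exposed_pair gN pq; have [_ _ pM'] := exposed_pair gM pr'.
  have pM : [set p.1; p.2] \in M.
    by apply: (edge_of_score mM (matching_acc mN pN)); rewrite e (mscore_edge mN pN).
  rewrite -ep in pM'; have e2 := matching_uniq mM pM pM'.
  by rewrite [p]surjective_pairing ep e2 -surjective_pairing.
apply: rotation_eq => // p pq; split; first exact: mem.
have pX := Xq p pq; have ltp := lt p pq.
have e : mscore T (elim M r) p.1 = mscore T (elim N q) p.1.
  apply/eqP; rewrite eqn_leq leN //=.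
  case: (rotation_dichotomy hT sU exM sN') => [] [h _]; last exact: h.
  have := leq_trans (leM _ pq) (h _ pX ltp).
  by rewrite leqNgt ltq.
have pr := mem _ pq.
have qN := elim_new N pq; have qM := elim_new M pr.
have mN' := elim_matching hT sU mN gN; have mM' := elim_matching hT sU mM gM.
apply: iM'; rewrite ?mem_next ?mem ?mem_next //.
apply: (matching_uniq mM' qM).
apply: (edge_of_score mM' (matching_acc mN' qN)).
by rewrite e (mscore_edge mN' qN).
Qed.

(** By the dichotomy for q, each matching along the chain is above N or below N/q on the agents of
    q. The step that passes from the first case to the second is a crossing, so it eliminates q
    itself. *)
Lemma rotation_passed M l N q p0 : M \in stables T U ->
  eliminable (exposed T X U) M l -> exposed T X U N q ->
  (forall p, p \in rot_seq q -> mscore T N p.1 <= mscore T M p.1) ->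
  p0 \in rot_seq q -> mscore T (foldl (@elim A) M l) p0.1 < mscore T N p0.1 ->
  q \in l.
Proof.
move=> + + exN + p0q; elim: l M => [|r l IH] M sM /=.
  by move=> _ leM; rewrite ltnNge leM.
case/andP=> ex el leM lt; rewrite inE; apply/orP.
have gN := exposed_gen exN; have mN := exposed_matching sU exN.
have sM' := elim_stable hT sU ex.
have ltq p : p \in rot_seq q -> mscore T (elim N q) p.1 < mscore T N p.1.
  exact: (elim_lt hT sU mN gN).
have Xq p : p \in rot_seq q -> p.1 \in X by case/(exposed_pair gN).
case: (rotation_dichotomy hT sU exN sM') => [] [h _].
  by right; apply: IH el _ lt => // p pq; apply: h; [apply: Xq | apply: ltq].
left; apply/eqP; apply: (crossing_rotation ex exN) => // p pq.
by apply: h; [apply: Xq | apply: ltq].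
Qed.

(** The final score of x along [l] is set by the last rotation of [l] containing x. That rotation
    also occurs in [l'], where it brings x down to the same value at some stage. *)
Lemma eliminable_subset_lower M l l' : M \in stables T U ->
  eliminable (exposed T X U) M l -> eliminable (exposed T X U) M l' ->
  {subset l <= l'} ->
  lower T X (foldl (@elim A) M l') (foldl (@elim A) M l).
Proof.
move=> sM + el'; elim/last_ind: l => [|l q IH] /=.
  by move=> _ _; have [] := eliminable_stable hT sU sM el'.
rewrite -cats1 eliminable_cat foldl_cat /= andbT => /andP[el ex] sub x xX.
have {}IH := IH el (fun r rl => sub r (mem_subseq (prefix_subseq _ _) rl)).
have ql' : q \in l' by apply: sub; rewrite mem_cat mem_head orbT.
have [N [exN _ low]] := eliminable_mem hT sU sM el' ql'.
have g1 := exposed_gen ex; have m1 := exposed_matching sU ex.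
have g2 := exposed_gen exN; have m2 := exposed_matching sU exN.
case: (boolP (x \in unzip1 (rot_seq q))) => [/mapP[p ps e]|xs].
  rewrite e in xX *; have := low _ xX.
  by rewrite (elim_mscore hT sU m1 g1 ps) (elim_mscore hT sU m2 g2 ps).
by rewrite (elim_unchanged hT sU m1 g1 xX xs) IH.
Qed.

(** M and N agree on the X-agents of r, so the join keeps its pairs; the classical condition
    survives because agents outside X get the minimum of two scores that both satisfy it. *)
Lemma exposed_join M N r : exposed T X U M r -> exposed T X U N r ->
  exposed T X U (join T X M N) r.
Proof.
move=> exM exN; have sM := exposed_in_stables exM; have sN := exposed_in_stables exN.
have mM := stables_matching sU sM; have mN := stables_matching sU sN.
have gM := exposed_gen exM; have gN := exposed_gen exN.
have [sJ Jx Jy] := join_stable hT sU sM sN; have mJ := stables_matching sU sJ.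
have [us _ _ _ _] := gen_exposed_facts gM.
apply/and3P; split=> //.
  case/and4P: (gM) => s0 u _ c; apply/and4P; split=> //; apply/allP => p ps.
  have [pX pX' pM] := exposed_pair gM ps; have [_ _ pN] := exposed_pair gN ps.
  by rewrite pX pX' in_join // pM pN leq_total.
case/and3P: exM => _ _ cM; case/and3P: exN => _ _ cN.
apply: cycle_from_next => // p ps.
have /forallP hM := next_cycle cM ps; have /forallP hN := next_cycle cN ps.
have [pX _ _] := exposed_pair gM ps.
apply/forallP => y; apply/implyP => h; case/and3P: (h) => py _ _.
have py' := acc_of_table sU py.
have yX : y \notin X by rewrite (acc_side hT py') pX.
have := implyP (hM y) h; have := implyP (hN y) h.
have okp : okpartner T y (Some p.1) by rewrite /= acc_sym.
rewrite !opref_score ?partner_ok // => lN lM.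
by rewrite -[score T y (partner _ y)]/(mscore T _ y) Jy // leq_min; apply/andP.
Qed.

Lemma rotations_first r : rotations T X U r ->
  exists2 N, exposed T X U N r & forall M, exposed T X U M r -> lower T X M N.
Proof.
case/exists_inP=> M0 _ ex0.
apply: (join_closed_max hT sU (P := fun M => exposed T X U M r) ex0).
  by move=> M; apply: exposed_in_stables.
by move=> M N; apply: exposed_join.
Qed.

Hypothesis nonempty : stables T U != set0.
Let top := side_opt T X U.
Let bottom := side_opt T (~: X) U.

Lemma side_opt_stable : top \in stables T U.
Proof. by have [] := side_opt_spec hT sU nonempty. Qed.

Lemma side_opt_top N : N \in stables T U -> lower T X N top.
Proof. by have [_] := side_opt_spec hT sU nonempty; apply. Qed.

Lemma side_opt_bottom N : N \in stables T U -> lower T X bottom N.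
Proof.
move=> sN x xX; have [sB hB] := side_opt_spec (marriage_setC hT) sU nonempty.
apply: (stable_opposite (marriage_setC hT) sU sN sB (hB _ sN)).
by rewrite !inE xX.
Qed.

Lemma bottom_stable : bottom \in stables T U.
Proof. by have [] := side_opt_spec (marriage_setC hT) sU nonempty. Qed.

(** With N the largest matching exposing r, any elimination sequence is below N when it reaches r,
    and so has already passed every rotation of [l]. This identifies R(r) with the members of one
    chain. *)
Lemma preceding_chain r N l : exposed T X U N r ->
  (forall M, exposed T X U M r -> lower T X M N) ->
  eliminable (exposed T X U) top l -> foldl (@elim A) top l = N ->
  forall q, q \in l <-> preceding T X U r q.
Proof.
move=> exN maxN el fl q; have sT := side_opt_stable.
have sN := exposed_in_stables exN.
have index_cons s1 s2 : uniq (s1 ++ r :: s2) -> index r (s1 ++ r :: s2) = size s1.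
  rewrite cat_uniq /= => /and3P[_ /norP[rs _] _].
  by rewrite index_cat (negbTE rs) /= eqxx addn0.
(* Continuing the chain through r to the bottom yields a sequence in which every rotation of U
   occurs; those preceding r there are exactly the members of [l]. *)
have [l2 el2 fl2] := exists_chain hT sU (elim_stable hT sU exN) bottom_stable
  (side_opt_bottom (elim_stable hT sU exN)).
have ell2 : eliminable (exposed T X U) top (l ++ r :: l2).
  by rewrite eliminable_cat el fl /= exN.
have ul := eliminable_uniq hT sU sT ell2.
split=> [ql|[/exists_inP[M sM exM] neq before]].
  have [M [exM lowM lowq]] := eliminable_mem hT sU sT el ql.
  split.
  - by apply/exists_inP; exists M => //; apply: exposed_in_stables exM.
  - apply/eqP => e; move: ul; rewrite cat_uniq /= -e ql.
    by case/and3P.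
  move=> s es qs rs; case/splitPr: rs es qs => s1 s2 es _.
  rewrite index_cons; last exact: eliminable_uniq es.
  move: (es); rewrite eliminable_cat /= => /and3P[es1 ex1 _].
  have [p pq] := rot_seq_exists (exposed_gen exM).
  have [pX _ _] := exposed_pair (exposed_gen exM) pq.
  have qs1 : q \in s1.
    apply: (rotation_passed sT es1 exM _ pq).
      by move=> p' pq'; apply: lowM; case: (exposed_pair (exposed_gen exM) pq').
    apply: leq_ltn_trans (maxN _ ex1 _ pX) _; rewrite -fl.
    apply: leq_ltn_trans (lowq _ pX) _.
    exact: (elim_lt hT sU (exposed_matching sU exM) (exposed_gen exM) pq).
  by rewrite index_cat qs1 index_mem.
have [p pq] := rot_seq_exists (exposed_gen exM).
have [pX _ _] := exposed_pair (exposed_gen exM) pq.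
have qall : q \in l ++ r :: l2.
  apply: (rotation_passed sT ell2 exM _ pq).
    move=> p' pq'; apply: side_opt_top => //.
    by case: (exposed_pair (exposed_gen exM) pq').
  rewrite foldl_cat fl /= fl2.
  apply: leq_ltn_trans (side_opt_bottom (elim_stable hT sU exM) pX) _.
  exact: (elim_lt hT sU (exposed_matching sU exM) (exposed_gen exM) pq).
have := before _ ell2 qall; rewrite mem_cat mem_head orbT => /(_ isT).
rewrite index_cons // index_cat; case: ifP => // _.
by rewrite ltnNge leq_addr.
Qed.

(** M_X/R(r) is well defined: two orders of elimination of the same set give matchings below each
    other, by [eliminable_subset_lower]. *)
Lemma preceding_elim_set r : rotations T X U r ->
  exists N, [/\ exposed T X U N r, elim_set (exposed T X U) top (preceding T X U r) N
    & forall M, elim_set (exposed T X U) top (preceding T X U r) M -> M = N].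
Proof.
move=> /rotations_first[N exN maxN]; have sN := exposed_in_stables exN.
have sT := side_opt_stable.
have [l el fl] := exists_chain hT sU sT sN (side_opt_top sN).
have lP := preceding_chain exN maxN el fl.
exists N; split=> //.
  by exists l; split=> //; apply: eliminable_uniq el.
move=> M [l' [_ l'P el' ->]]; rewrite -fl.
have m k : eliminable (exposed T X U) top k ->
    foldl (@elim A) top k \in matchings (edges T).
  by move=> ek; apply: (stables_matching sU); have [] := eliminable_stable hT sU sT ek.
apply: (lower_anti hT (m _ el') (m _ el)); apply: eliminable_subset_lower => // q.
  by move/lP/l'P.
by move/l'P/lP.
Qed.

End Preceding.

(** * Extending internally stable families *)

Section Extensions.
Variables (A : finType) (T : roommate A) (X : {set A}).
Hypothesis hT : marriage T X.
Implicit Types (x y z : A) (M N L K U V : {set {set A}}) (r q : rotation A)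
  (p : A * A) (l : seq (rotation A)).

Lemma stable_table_nonempty U : U \subset edges T -> stable_table T U ->
  stables T U != set0.
Proof.
move=> sU /forall_inP stU; have [U0|/set0Pn[e eU]] := eqVneq U set0.
  apply/set0Pn; exists set0; apply/stablesP => //; split; rewrite ?sub0set //.
    by rewrite inE sub0set; apply/trivIsetP => e f; rewrite inE.
  by move=> a b; rewrite U0 inE.
by have /exists_inP[M sM _] := stU e eU; apply/set0Pn; exists M.
Qed.

(** If the optimum M' of V differed from the optimum M of U, edges of M would lead from gaining
    X-agents to losing agents of the other side, and edges of M' back to gaining X-agents. These are
    arcs of the digraph of M, and such a walk never stops. *)
Lemma acyclic_side_opt U V : U \subset edges T -> V \subset edges T ->
  stables T U \subset stables T V -> stables T U != set0 ->
  acyclic (side_digraph T (~: X) (side_opt T X U) (edges T)) ->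
  side_opt T X U = side_opt T X V.
Proof.
move=> sU sV /subsetP sUV nU acyc.
have nV : stables T V != set0.
  by case/set0Pn: nU => M /sUV sM; apply/set0Pn; exists M.
have sM := sUV _ (side_opt_stable hT sU nU).
have lowM := side_opt_top hT sV nV sM; have sM' := side_opt_stable hT sV nV.
set M := side_opt T X U in acyc sM lowM *; set M' := side_opt T X V in lowM sM' *.
have mM := stables_matching sV sM; have mM' := stables_matching sV sM'.
have uMM' := stables_unblocked sV sM sM'; have uM'M := stables_unblocked sV sM' sM.
apply: (matching_eq hT mM mM') => x0 x0X; apply/eqP; rewrite eqn_leq lowM //= leqNgt.
apply/negP => lt0.
pose S := [pred a | if a \in X then mscore T M a < mscore T M' a
                    else mscore T M' a < mscore T M a].
have [||c uc] := @exists_ucycle _ (side_digraph T (~: X) M (edges T)) S x0.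
- by rewrite inE x0X.
- move=> a; rewrite inE; case: ifPn => aX lt.
    have [b ab ltb] := prefers_decomposition mM' mM uM'M uMM' lt.
    have bX := matching_side hT mM ab; rewrite aX in bX.
    exists b; first by rewrite inE bX.
    by rewrite /side_digraph !inE aX bX (partner_Some mM ab) eqxx orbT.
  have [b ab ltb] := prefers_decomposition mM mM' uMM' uM'M lt.
  have bX := matching_side hT mM' ab; rewrite aX in bX.
  exists b; first by rewrite inE bX.
  have accab := matching_acc mM' ab.
  rewrite /side_digraph !inE aX bX edgesE accab !opref_score ?partner_ok //=;
    last by rewrite acc_sym.
  by rewrite -(mscore_edge mM' ab) -(mscore_edge_sym mM' ab) ltb [X in X || _]lt.
by rewrite (acyc c uc).
Qed.

(** Every second arc of the cycle is an edge of M, so its vertices in X, with two steps as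
    successor, carry a generalized rotation. Eliminating one at the bottom M goes below every stable
    matching for X and above it for the other side, which excludes blocking in either direction. *)
Lemma cycle_extension U M c : U \subset edges T -> M \in stables T U ->
  (forall N, N \in stables T U -> lower T X M N) ->
  ucycle (side_digraph T X M (edges T)) c -> c != [::] ->
  exists N, [/\ N \in matchings (edges T), N \notin stables T U
    & forall L, L \in stables T U -> unblocked T L N /\ unblocked T N L].
Proof.
move=> sU sM lowM /andP[cc uc] c0; have mM := stables_matching sU sM.
pose C := [pred x | (x \in c) && (x \in X)].
pose g x := next c (next c x).
have Dx x : x \in C -> [/\ g x \in C, next c x \notin X, acc T x (next c x),
    score T x (Some (next c x)) < mscore T M x
  & mscore T M (next c x) < score T (next c x) (Some x)
    /\ [set g x; next c x] \in M].
  case/andP=> xc xX; have xc' : next c x \in c by rewrite mem_next.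
  have /orP[/and5P[_ yX xy h1 h2]|/and3P[]] := next_cycle cc xc; last by rewrite xX.
  rewrite edgesE in xy.
  have /orP[/and5P[]|/and3P[_ gX]] := next_cycle cc xc'; first by rewrite (negbTE yX).
  rewrite (partnerE mM) setUC => gM.
  have okx : okpartner T x (Some (next c x)) by [].
  have oky : okpartner T (next c x) (Some x) by rewrite /= acc_sym.
  rewrite opref_score ?partner_ok // in h1; rewrite opref_score ?partner_ok // in h2.
  by rewrite !inE mem_next xc' gX.
have [x0 x0C] : exists x, x \in C.
  case: c c0 @C @g Dx cc uc => [//|a c] _ C g Dx cc uc.
  case aX: (a \in X); first by exists a; rewrite !inE eqxx aX.
  have := next_cycle cc (mem_head a c); rewrite /side_digraph aX /= => /andP[nX _].
  by exists (next (a :: c) a); apply/andP; rewrite mem_next mem_head.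
have mCM x : x \in C -> [/\ x \in X, mate M x \notin X & [set x; mate M x] \in M].
  move=> xC; have [_ _ _ lt _] := Dx x xC; have xX : x \in X by case/andP: xC.
  have [y xy] := mscore_gt0 mM (leq_ltn_trans (leq0n _) lt).
  by rewrite /mate (partner_Some mM xy) /= xX xy (matching_side hT mM xy) xX.
have [r gex _] : exists2 r, gen_exposed T X (edges T) M r & forall p, p \in rot_seq r ->
    [/\ p.1 \in C, p.2 = mate M p.1 & next (rot_seq r) p = (g p.1, mate M (g p.1))].
  apply: (rotation_intro mM x0C mCM) => x xC.
  have [gC _ xy ltx [lty gM]] := Dx x xC; have [xX yX xm] := mCM x xC.
  have -> : mate M (g x) = next c x by rewrite /mate (partner_Some mM gM).
  rewrite edgesE xy !pref_scoreE ?(matching_acc mM xm) // 1?acc_sym ?(matching_acc mM gM) //.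
  by rewrite -(mscore_edge mM xm) ltx -(mscore_edge_sym mM gM) lty.
have sE := subxx (edges T).
have mN := elim_matching hT sE mM gex.
have lowN := elim_lower hT sE mM gex.
exists (elim M r); split=> //.
  apply/negP => /lowM lowM'; have /eqP[] := elim_neq hT sE mM gex.
  exact: lower_anti lowN lowM'.
move=> L sL; have mL := stables_matching sU sL.
split; apply: (unblocked_intro hT); [by case/setIdP: mL| |by case/setIdP: mN|];
  move=> x y xX yX xy.
  apply/orP; right; rewrite -(mscore_edge_sym mL xy).
  apply: leq_trans (elim_upper hT sE mM gex yX).
  exact: (stable_opposite hT sU sM sL (lowM _ sL)).
apply/orP; left; rewrite -(mscore_edge mN xy).
exact: leq_trans (lowN _ xX) (lowM _ sL _ xX).
Qed.

Lemma internally_closed_add F N : internally_closed T F ->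
  N \in matchings (edges T) ->
  (forall L, L \in F -> unblocked T L N /\ unblocked T N L) -> N \in F.
Proof.
case/maxsetP=> /andP[mF iF] maxF mN uN.
have mG : N |: F \subset matchings (edges T) by rewrite subUset sub1set mN.
suff iG : internally_stable T (N |: F).
  by rewrite -(maxF (N |: F)) ?mG ?subsetUr // setU11.
apply/forall_inP => M MG; apply/forall_inP => L LG.
have mM := subsetP mG _ MG; have mL := subsetP mG _ LG.
have [MF|MF] := boolP (M \in F); have [LF|LF] := boolP (L \in F).
- by have /forall_inP/(_ _ MF)/forall_inP := iF; apply.
- have := LG; rewrite inE (negbTE LF) orbF inE => /eqP->.
  by apply/(blocksE (T := T)) => //; case: (uN _ MF).
- have := MG; rewrite inE (negbTE MF) orbF inE => /eqP->.
  by apply/(blocksE (T := T)) => //; case: (uN _ LF).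
have := MG; rewrite inE (negbTE MF) orbF inE => /eqP->.
have := LG; rewrite inE (negbTE LF) orbF inE => /eqP->.
by apply/(blocksE (T := T)) => // a b ab; rewrite (mscore_edge mN ab) leqnn.
Qed.

(** K need be neither stable nor contained in U. Agents whose score r leaves unchanged see K as they
    see N; for the others the dichotomy puts L on one side of the whole interval. *)
Lemma between_unblocked U N r K L : U \subset edges T -> exposed T X U N r ->
  L \in stables T U -> K \in matchings (edges T) ->
  lower T X (elim N r) K -> lower T X K N ->
  (forall y, y \notin X -> mscore T N y <= mscore T K y) ->
  (forall y, y \notin X -> mscore T K y <= mscore T (elim N r) y) ->
  unblocked T L K /\ unblocked T K L.
Proof.
move=> sU ex sL mK lo hi lo' hi'.
have mL := stables_matching sU sL.
have sN := exposed_in_stables ex; have sN' := elim_stable hT sU ex.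
have sub M : M \in matchings (edges T) -> M \subset edges T by case/setIdP.
split; apply: (unblocked_intro hT); [exact: sub| |exact: sub|];
  move=> x y xX yX xy.
  have xyU := subsetP (stables_subset sU sL) _ xy.
  have := stables_no_block sU sN xyU; have := stables_no_block sU sN' xyU.
  have := lo x xX; have := hi x xX; have := lo' y yX; have := hi' y yX.
  rewrite -(mscore_edge mL xy) -(mscore_edge_sym mL xy).
  case: (rotation_dichotomy hT sU ex sL) => [] [/(_ x xX) + /(_ y yX)]; clear; lia.
(* An edge of K with an end whose score is as in N is an edge of N. Otherwise r changes both ends,
   and the dichotomy puts L weakly above K at x or at y. *)
have inN : [set x; y] \in N ->
    (score T x (Some y) <= mscore T L x) || (score T y (Some x) <= mscore T L y).
  by move=> xyN; apply: (stables_unblocked sU sN sL).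
have xyT := matching_acc mK xy; have mN := stables_matching sU sN.
have := hi x xX; rewrite leq_eqVlt => /orP[/eqP e|ltx].
  by apply/inN/(edge_of_score mN xyT); rewrite -e (mscore_edge mK xy).
have := lo' y yX; rewrite leq_eqVlt => /orP[/eqP e|lty].
  apply: inN; rewrite setUC; apply: (edge_of_score mN); first by rewrite acc_sym.
  by rewrite e (mscore_edge_sym mK xy).
rewrite -(mscore_edge mK xy) -(mscore_edge_sym mK xy).
have := lo x xX; have := hi' y yX; move: ltx lty.
case: (rotation_dichotomy hT sU ex sL) => [] [/(_ x xX) + /(_ y yX)]; clear; lia.
Qed.

End Extensions.

Lemma in_bigcup_seqP (I : eqType) (B : finType) (f : I -> {set B}) (s : seq I) (b : B) :
  reflect (exists2 i, i \in s & b \in f i) (b \in \bigcup_(i <- s) f i).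
Proof.
apply: (iffP idP) => [|[i i_s bi]].
  elim: s => [|i s IH]; rewrite ?big_nil ?inE // big_cons inE => /orP[bi|/IH[j js bj]].
    by exists i; rewrite ?mem_head.
  by exists j; rewrite // inE js orbT.
by rewrite (big_rem i) //= inE bi.
Qed.

(** * Dissections and proper extensions of the lattice *)

Section Dissections.
Variables (A : finType) (T : roommate A) (X : {set A}).
Hypothesis hT : marriage T X.
Implicit Types (x y z : A) (M N L K U V W : {set {set A}}) (r q : rotation A)
  (p : A * A) (l : seq (rotation A)).

Lemma gen_exposed_sub U V M r : U \subset V -> gen_exposed T X U M r ->
  gen_exposed T X V M r.
Proof.
move=> /subsetP sUV ex; have [us _ _ _ h] := gen_exposed_facts ex.
case/and4P: ex => s0 u sM _; apply/and4P; split=> //.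
by apply: cycle_from_next => // p /h /=[_ [/sUV pV p1 p2]]; apply/and3P.
Qed.

Lemma rot_edges_sub U M r : U \subset edges T -> M \in matchings (edges T) ->
  gen_exposed T X U M r -> M \subset U -> rot_edges r \subset U.
Proof.
move=> sU mM ex sM; rewrite subUset; apply/andP; split; apply/subsetP => _ /imsetP[p ps ->].
  by have [_ _ /(subsetP sM)] := exposed_pair ex ps.
by have [] := exposed_next sU mM ex ps.
Qed.

Lemma gen_eliminable_bounds U M l : U \subset edges T -> M \in matchings (edges T) ->
  eliminable (gen_exposed T X U) M l ->
  lower T X (foldl (@elim A) M l) M /\
  forall y, y \notin X -> mscore T M y <= mscore T (foldl (@elim A) M l) y.
Proof.
move=> sU; elim: l M => [|r l IH] M mM /=; first by move=> _; split=> [x|y].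
case/andP=> ex /(IH _ (elim_matching hT sU mM ex))[lo hi]; split=> [x xX|y yX].
  exact: leq_trans (lo _ xX) (elim_lower hT sU mM ex xX).
exact: leq_trans (elim_upper hT sU mM ex yX) (hi _ yX).
Qed.

(** Equal eliminations give q the new edges and the skipped ranges of r, hence the classical
    condition in U. *)
Lemma exposed_transfer U M r q : U \subset edges T -> exposed T X U M r ->
  gen_exposed T X (edges T) M q -> elim M q = elim M r -> exposed T X U M q.
Proof.
move=> sU ex gq e; have sM := exposed_in_stables ex.
have mM := stables_matching sU sM; have [us _ _ _ h] := gen_exposed_facts gq.
have sE := subxx (edges T).
have newU p : p \in rot_seq q -> [set p.1; (next (rot_seq q) p).2] \in U.
  move=> ps; apply: (subsetP (stables_subset sU (elim_stable hT sU ex))).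
  by rewrite -e; apply: elim_new.
apply/and3P; split=> //.
  case/and4P: gq => s0 u sq _; apply/and4P; split=> //.
  apply: cycle_from_next => // p ps; have /=[_ [_ p1 p2]] := h p ps.
  by apply/and3P; split=> //; apply: newU.
apply: cycle_from_next => // p ps; apply/forallP => y; apply/implyP => /and3P[py].
have [pX _ pM] := exposed_pair gq ps.
have lt := elim_lt hT sE mM gq ps.
have py' := acc_of_table sU py; have new' := acc_of_table sU (newU p ps).
rewrite !pref_scoreE // ?(matching_acc mM pM) // => h1 h2.
rewrite opref_score ?partner_ok //; last by rewrite /= acc_sym.
rewrite -(mscore_edge mM pM) in h1; rewrite -(elim_mscore hT sE mM gq ps) in h2.
rewrite e in lt h2; have [p' ps' ep] := elim_changed hT sU mM (exposed_gen ex) pX lt.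
rewrite ep in py h1 h2 *; exact: (exposed_between hT sU ex ps').
Qed.

(** Let q be the first rotation eliminated in the dissection. N/q lies between N and N/r, so
    closedness makes it stable for U, and the dichotomy leaves only N/q = N/r. Then q is a rotation
    of U, against condition (i). *)
Lemma closed_no_dissection U r Rs : U \subset edges T ->
  internally_closed T (stables T U) -> stables T U != set0 -> rotations T X U r ->
  {in Rs, forall q, gen_rotation T X (edges T) q} -> ~ dissection T X U r Rs.
Proof.
move=> sU cU nU rU gR [hR [N0 [preN0 [l [ul lR el eN]]]]].
have [N [ex _ uniqN]] := preceding_elim_set hT sU nU rU.
rewrite (uniqN _ preN0) in el eN; set Us := U :|: _ in hR el.
have sE := subxx (edges T); have mN := exposed_matching sU ex.
have sUs : Us \subset edges T.
  rewrite subUset sU; apply/subsetP => e /in_bigcup_seqP[q qR].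
  have /exists_inP[M mM gq] := gR q qR; move: e; apply/subsetP.
  by apply: (rot_edges_sub sE mM gq); case/setIdP: mM.
case: l => [|q l] /= in ul lR el eN.
  by have := elim_neq hT sU mN (exposed_gen ex); rewrite eN eqxx.
case/andP: el => gq el; have mK := elim_matching hT sUs mN gq.
have [lo hi] := gen_eliminable_bounds sUs mK el; rewrite -eN in lo hi.
have lowK := elim_lower hT sUs mN gq.
have upK := fun y => @elim_upper _ _ _ hT _ _ _ sUs mN gq y.
have sK : elim N q \in stables T U.
  apply: (internally_closed_add cU mK) => L sL.
  exact: (between_unblocked hT sU ex sL mK lo lowK upK hi).
have neqK := elim_neq hT sUs mN gq.
have eK : elim N q = elim N r.
  have mN' := stables_matching sU (elim_stable hT sU ex).
  case: (rotation_dichotomy hT sU ex sK) => [] [h _].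
    case/eqP: neqK; apply: (matching_eq hT mK mN) => x xX; apply/eqP.
    rewrite eqn_leq lowK //=; have := elim_lower hT sU mN (exposed_gen ex) xX.
    rewrite leq_eqVlt => /orP[/eqP<-|/h]; first exact: lo.
    exact.
  apply: (matching_eq hT mK mN') => x xX; apply/eqP; rewrite eqn_leq lo // andbT.
  have := elim_lower hT sU mN (exposed_gen ex) xX.
  rewrite leq_eqVlt => /orP[/eqP->|/h]; first exact: lowK.
  exact.
have qR : q \in Rs by apply/lR; rewrite mem_head.
have := hR q qR; case/andP=> _ /negP[]; apply/exists_inP; exists N.
  exact: exposed_in_stables ex.
exact: (exposed_transfer sU ex (gen_exposed_sub sUs gq) eK).
Qed.

Lemma internally_closed_table F : internally_closed T F ->
  exists U, [/\ U \subset edges T, stable_table T U & F = stables T U].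
Proof.
move=> cF; case/maxsetP: (cF) => /andP[mF iF] maxF.
have [sV sF] := internally_stable_sub_stables mF iF.
have e : stables T (cover F) = F.
  apply: maxF sF; rewrite stables_internally_stable // andbT.
  by apply/subsetP => M /(stables_matching sV).
exists (cover F); split=> //; apply/forall_inP => f /bigcupP[M MF fM].
by apply/exists_inP; exists M; rewrite ?e.
Qed.

(** Stability and the classical condition quantify over all edges of the table, so they pass to a
    smaller table containing the edges in use. *)
Lemma eliminable_shrink V W N l : V \subset edges T -> W \subset V -> N \subset W ->
  (forall q, q \in l -> rot_edges q \subset W) ->
  eliminable (exposed T X V) N l -> eliminable (exposed T X W) N l.
Proof.
move=> sV sWV; elim: l N => //= q l IH N sNW sW /andP[ex el].
have sqW := sW q (mem_head _ _).
have newW : rot_new q \subset W by apply: subset_trans sqW; apply: subsetUr.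
apply/andP; split; last first.
  apply: IH el; last by move=> q' ql; apply: sW; rewrite inE ql orbT.
  by rewrite subUset newW andbT; apply: subset_trans sNW; apply: subsetDl.
have gex := exposed_gen ex; have [us _ _ _ h] := gen_exposed_facts gex.
case/and3P: ex => sN _ cN; case/(stablesP _ sV): sN => mN _ uN.
apply/and3P; split.
- apply/stablesP; first exact: subset_trans sWV sV.
  by split=> //; apply: unblocked_sub uN.
- case/and4P: gex => s0 u sM _; apply/and4P; split=> //.
  apply: cycle_from_next => // p ps; have /=[_ [_ p1 p2]] := h p ps.
  apply/and3P; split=> //; apply: (subsetP newW); apply/imsetP.
  by exists p.
apply: cycle_from_next => // p ps; apply/forallP => y; apply/implyP => /and3P[py h1 h2].
have /forallP/(_ y)/implyP := next_cycle cN ps; apply.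
by rewrite (subsetP sWV) // h1 h2.
Qed.

Lemma eliminable_imply (ex ex' : {set {set A}} -> rotation A -> bool) M l :
  (forall N q, ex N q -> ex' N q) -> eliminable ex M l -> eliminable ex' M l.
Proof. by move=> h; elim: l M => //= q l IH M /andP[/h-> /IH]. Qed.

(* If q were also a rotation of U, the dichotomy for r would force q to move
   exactly the agents of r, so that q would cover the whole interval. *)
Lemma proper_step_not_rotation U V N r N1 q K : U \subset edges T -> V \subset edges T ->
  exposed T X U N r -> exposed T X V N1 q ->
  lower T X N1 N -> lower T X (elim N r) (elim N1 q) ->
  lower T X N1 K \/ lower T X K (elim N1 q) ->
  (exists2 x, x \in X & mscore T (elim N r) x < mscore T K x < mscore T N x) ->
  ~~ rotations T X U q.
Proof.
move=> sU sV exN exN1 lowN lowN' side [x0 x0X /andP[lt1 lt2]].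
apply/negP => /exists_inP[M1 _ exM].
have gM := exposed_gen exM; have gN1 := exposed_gen exN1.
have mM := exposed_matching sU exM; have mN1 := exposed_matching sV exN1.
have sM := exposed_in_stables exM; have sM' := elim_stable hT sU exM.
have eqold p : p \in rot_seq q -> mscore T N1 p.1 = mscore T M1 p.1.
  by move=> ps; rewrite (exposed_mscore mM gM ps) (exposed_mscore mN1 gN1 ps).
have eqnew p : p \in rot_seq q -> mscore T (elim N1 q) p.1 = mscore T (elim M1 q) p.1.
  by move=> ps; rewrite (elim_mscore hT sU mM gM ps) (elim_mscore hT sV mN1 gN1 ps).
have ltq p : p \in rot_seq q -> mscore T (elim M1 q) p.1 < mscore T M1 p.1.
  exact: (elim_lt hT sU mM gM).
have [p ps] := rot_seq_exists gM; have [pX _ _] := exposed_pair gM ps.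
have leN := lowN _ pX; have leN' := lowN' _ pX; have ltp := ltq _ ps.
rewrite eqold // in leN; rewrite eqnew // in leN'.
have chp := leq_ltn_trans leN' (leq_trans ltp leN).
have hi : forall x, x \in X -> mscore T (elim N r) x < mscore T N x ->
    mscore T N x <= mscore T M1 x.
  case: (rotation_dichotomy hT sU exN sM) => [] [h _] //.
  by have := leq_trans (leq_trans ltp (h _ pX chp)) leN'; rewrite ltnn.
have lo : forall x, x \in X -> mscore T (elim N r) x < mscore T N x ->
    mscore T (elim M1 q) x <= mscore T (elim N r) x.
  case: (rotation_dichotomy hT sU exN sM') => [] [h _] //.
  by have := leq_trans (leq_trans ltp leN) (h _ pX chp); rewrite ltnn.
have ch0 := ltn_trans lt1 lt2.
have [p0 ps0 e0] : exists2 p, p \in rot_seq q & x0 = p.1.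
  apply: (elim_changed hT sU mM gM x0X).
  by apply: leq_ltn_trans (lo _ x0X ch0) _; apply: leq_trans ch0 (hi _ x0X ch0).
have := hi _ x0X ch0; have := lo _ x0X ch0; move: lt1 lt2.
rewrite e0 -eqold // -eqnew // -e0.
by case: side => /(_ _ x0X); clear; lia.
Qed.

Lemma exists_dissection U V : U \subset edges T -> V \subset edges T ->
  stables T U != set0 -> stables T U \subset stables T V ->
  side_opt T X U = side_opt T X V -> side_opt T (~: X) U = side_opt T (~: X) V ->
  U \subset V -> stable_table T V -> ~~ (V \subset U) ->
  exists r, rotations T X U r /\ exists Rs : seq (rotation A),
    {in Rs, forall q, gen_rotation T X (edges T) q} /\ dissection T X U r Rs.
Proof.
move=> sU sV nU /subsetP sUV etop ebot subUV /forall_inP stV.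
case/subsetPn=> e eV eU.
have [x [y [xX yX xy ee]]] := edges_side hT (subsetP sV _ eV).
rewrite {}ee in eV eU; have /exists_inP[M' sM' xyM'] := stV _ eV.
have mM' := stables_matching sV sM'; have scM' := mscore_edge mM' xyM'.
have nV : stables T V != set0 by apply/set0Pn; exists M'.
have sT := side_opt_stable hT sU nU; have sB := bottom_stable hT sU nU.
have neq_score N : N \in stables T U -> mscore T N x != score T x (Some y).
  move=> sN; apply: contraNneq eU => eN.
  apply: (subsetP (stables_subset sU sN)).
  exact: (edge_of_score (stables_matching sU sN) xy).
(* A tie at x would put xy in U. So a matching of least total score in [P] is one where any further
   elimination takes x past y; [P] is inhabited because U and V share their X-optimum. *)
pose P N := (N \in stables T U) && (score T x (Some y) < mscore T N x).
have PT : P (side_opt T X U).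
  rewrite /P sT /= ltn_neqAle eq_sym neq_score //= -scM' etop.
  exact: (side_opt_top hT sV nV sM').
have [N /andP[sN ltN] minN] :=
  @arg_minnP _ _ P (fun N => \sum_(z in X) mscore T N z) PT.
have lowB := side_opt_bottom hT sU nU sN.
have [|r exr _] := exists_rotation hT sU sN sB lowB.
  apply: contraTneq ltN => <-; rewrite -leqNgt -scM' ebot.
  exact: (side_opt_bottom hT sV nV sM').
have gexr := exposed_gen exr; have mN := stables_matching sU sN.
have ltr : mscore T (elim N r) x < score T x (Some y).
  rewrite ltn_neqAle neq_score ?(elim_stable hT sU exr) //= leqNgt; apply/negP => lt.
  have := minN (elim N r); rewrite /P (elim_stable hT sU exr) lt => /(_ isT).
  by rewrite leqNgt (elim_total_lt hT sU exr).
have [p ps xp] := elim_changed hT sU mN gexr xX (ltn_trans ltr ltN).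
have rU : rotations T X U r by apply/exists_inP; exists N.
exists r; split=> //.
have [N0 [ex0 pre0 _]] := preceding_elim_set hT sU nU rU.
have g0 := exposed_gen ex0; have s0 := exposed_in_stables ex0.
have m0 := stables_matching sU s0.
have s0' := elim_stable hT sU ex0.
(* The old and new partners of x belong to r itself, so the skip over y carries over from N to N0 =
   M_X/R(r). *)
have lt0 : score T x (Some y) < mscore T N0 x.
  by move: ltN; rewrite xp (exposed_mscore mN gexr ps) (exposed_mscore m0 g0 ps).
have lt0' : mscore T (elim N0 r) x < score T x (Some y).
  by move: ltr; rewrite xp (elim_mscore hT sU mN gexr ps) (elim_mscore hT sU m0 g0 ps).
(* Truncating M' to the interval from N0/r to N0 keeps its partner y at x, so K lies strictly inside
   the interval there. *)
have [K [sK Kx _]] := median_stable hT sV sM' (sUV _ s0') (sUV _ s0).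
have low0 := elim_lower hT sU m0 g0.
have KN : lower T X K N0 by move=> z zX; rewrite Kx // geq_minr.
have NK : lower T X (elim N0 r) K.
  by move=> z zX; rewrite Kx // leq_min low0 // leq_maxr.
have Kx0 : mscore T K x = score T x (Some y).
  by rewrite Kx // scM'; move: lt0 lt0'; clear; lia.
have [l1 el1 fl1] := exists_chain hT sV (sUV _ s0) sK KN.
have [l2 el2 fl2] := exists_chain hT sV sK (sUV _ s0') NK.
have el : eliminable (exposed T X V) N0 (l1 ++ l2) by rewrite eliminable_cat el1 fl1.
have ul := eliminable_uniq hT sV (sUV _ s0) el.
have step q : q \in l1 ++ l2 -> exists N1, [/\ exposed T X V N1 q, lower T X N1 N0,
    lower T X (elim N0 r) (elim N1 q) & lower T X N1 K \/ lower T X K (elim N1 q)].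
  rewrite mem_cat => /orP[ql|ql].
    have [N1 [ex1 low1 low1']] := eliminable_mem hT sV (sUV _ s0) el1 ql.
    rewrite fl1 in low1'; exists N1; split=> //; last by right.
    by move=> z zX; apply: leq_trans (NK _ zX) (low1' _ zX).
  have [N1 [ex1 low1 low1']] := eliminable_mem hT sV sK el2 ql.
  rewrite fl2 in low1'; exists N1; split=> //; last by left.
  by move=> z zX; apply: leq_trans (low1 _ zX) (KN _ zX).
exists (l1 ++ l2); split.
  move=> q /step[N1 [ex1 _ _ _]]; apply/exists_inP; exists N1.
    exact: (exposed_matching sV ex1).
  exact: (gen_exposed_sub sV (exposed_gen ex1)).
(* The chain lives in V, whereas the conditions concern T^*, here [W], which may be smaller;
   [eliminable_shrink] brings the chain down to it. *)
rewrite /dissection; set W := U :|: _.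
have sWV : W \subset V.
  rewrite subUset subUV; apply/subsetP => f /in_bigcup_seqP[q /step].
  case=> N1 [ex1 _ _ _]; move: f; apply/subsetP.
  apply: (rot_edges_sub sV (exposed_matching sV ex1) (exposed_gen ex1)).
  exact: (stables_subset sV (exposed_in_stables ex1)).
have elW : eliminable (exposed T X W) N0 (l1 ++ l2).
  apply: (eliminable_shrink sV sWV _ _ el).
    by apply: subset_trans (stables_subset sU s0) _; apply: subsetUl.
  move=> q ql; apply/subsetP => f fq; rewrite inE; apply/orP; right.
  by apply/in_bigcup_seqP; exists q.
have sW := subset_trans sWV sV.
have s0W : N0 \in stables T W.
  case/(stablesP _ sV): (sUV _ s0) => _ _ u0; apply/stablesP => //; split=> //.
    by apply: subset_trans (stables_subset sU s0) _; apply: subsetUl.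
  exact: unblocked_sub u0.
split.
  move=> q ql; apply/andP; split.
    have [N1 [ex1 _ _]] := eliminable_mem hT sW s0W elW ql.
    by apply/exists_inP; exists N1 => //; apply: exposed_in_stables ex1.
  have [N1 [ex1 low1 low1' side]] := step q ql.
  apply: (proper_step_not_rotation sU sV ex0 ex1 low1 low1' side).
  by exists x; rewrite // Kx0 lt0' lt0.
exists N0; split=> //; exists (l1 ++ l2); split=> //.
  by apply: eliminable_imply elW => M q; apply: exposed_gen.
by rewrite foldl_cat fl1 fl2.
Qed.

Lemma cover_stables U : U \subset edges T -> stable_table T U ->
  cover (stables T U) = U.
Proof.
move=> sU /forall_inP stU; apply/eqP; rewrite eqEsubset; apply/andP; split.
  by apply/bigcupsP => M /(stables_subset sU).
apply/subsetP => e eU; have /exists_inP[M sM eM] := stU _ eU.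
by apply/bigcupP; exists M.
Qed.

End Dissections.

Theorem theorem5 (A : finType) (T : roommate A) (X : {set A})
    (hT : marriage T X) (F : {set {set {set A}}})
    (hF : F \subset matchings (edges T)) :
  let P1 := internally_closed T F : Prop in
  let P2 := maxset (fun G : {set {set {set A}}} =>
              [&& G \subset matchings (edges T), join_closed T X G
                & opposition T X G]) F : Prop in
  let P3 := exists U : {set {set A}},
    [/\ U \subset edges T,
        stable_table T U,
        F = stables T U,
        acyclic (side_digraph T X (side_opt T (~: X) U) (edges T)) /\
        acyclic (side_digraph T (~: X) (side_opt T X U) (edges T))
      & forall r : rotation A, rotations T X U r ->
          ~ exists Rs : seq (rotation A),
              {in Rs, forall q, gen_rotation T X (edges T) q} /\
              dissection T X U r Rs] in
  (P1 <-> P2) /\ (P2 <-> P3).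
Proof.
have hTC := marriage_setC hT.
move=> P1 P2 P3; have P12 : P1 <-> P2 := internally_closed_iff hT F.
suff P13 : P1 <-> P3 by split=> //; rewrite -P12.
split=> [cF|[U [sU stU eF [acX acY] noR]]].
  have [U [sU stU eF]] := internally_closed_table cF.
  have nU := stable_table_nonempty sU stU; rewrite /P1 eF in cF.
  (* Stated for an arbitrary side [Z], so that both digraphs are handled by exchanging X and its
     complement. *)
  have extend Z M c : marriage T Z -> M \in stables T U ->
      (forall N, N \in stables T U -> lower T Z M N) ->
      ucycle (side_digraph T Z M (edges T)) c -> c = [::].
    move=> hZ sM lowM uc; apply/eqP; apply/negPn/negP => c0.
    have [N [mN nN uN]] := cycle_extension hZ sU sM lowM uc c0.
    by case/negP: nN; apply: (internally_closed_add cF).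
  exists U; split=> //; first split=> c.
  - by apply: (extend _ _ _ hT); [exact: bottom_stable | exact: side_opt_bottom].
  - apply: (extend _ _ _ hTC); first exact: side_opt_stable.
    by have := @side_opt_bottom _ _ _ hTC _ sU nU; rewrite setCK.
  by move=> r rU [Rs [gR]]; apply: (closed_no_dissection hT sU cF nU rU gR).
have nU := stable_table_nonempty sU stU.
apply/maxsetP; split; first by rewrite hF eF stables_internally_stable.
move=> G /andP[mG iG] sFG; have [sV sG] := internally_stable_sub_stables mG iG.
set V := cover G in sV sG.
have sUV : stables T U \subset stables T V by rewrite -eF; apply: subset_trans sG.
have subUV : U \subset V.
  rewrite -(cover_stables sU stU) -eF; apply/bigcupsP => M MF.
  by apply: bigcup_sup; apply: (subsetP sFG).
have stV : stable_table T V.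
  apply/forall_inP => e /bigcupP[M MG eM].
  by apply/exists_inP; exists M => //; apply: (subsetP sG).
have etop := acyclic_side_opt hT sU sV sUV nU acY.
have ebot : side_opt T (~: X) U = side_opt T (~: X) V.
  by apply: (acyclic_side_opt hTC sU sV sUV nU); rewrite setCK.
have subVU : V \subset U.
  apply/negPn/negP => nVU.
  have [r [rU dR]] := exists_dissection hT sU sV nU sUV etop ebot subUV stV nVU.
  exact: noR rU dR.
have eVU : V = U by apply/eqP; rewrite eqEsubset subVU.
by apply/eqP; rewrite eqEsubset sFG eF -eVU sG.
Qed.
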